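(* The following map $\varphi$ defines an isomorphism of Lie algebras from $\overline L(\mathcal G,\pi)$ to $\overline L(\mathcal G,\theta)$ (for all $\underline r\in\mathbb Z^N$ and all $r_0\in\mathbb Z$ for which the element on the left lies in $\overline L(\mathcal G,\pi)$): (1) $\varphi(x_\alpha\otimes t^{r_0}t^{\underline r})=x_\alpha\otimes t^{r_0\frac mK+N(\alpha)}t^{\underline r}$; (2) $\varphi(h_\alpha t^{r_0}t^{\underline r})=h_\alpha t^{r_0\frac mK}t^{\underline r}+\langle x_\alpha,\mathbf w(x_\alpha)\rangle\frac{N(\alpha)}{m}t^{r_0\frac mK}t^{\underline r}k_0$, where $h_\alpha=[x_\alpha,\mathbf w(x_\alpha)]$; (3) $\varphi(t^{r_0}t^{\underline r}k_i)=t^{r_0\frac mK}t^{\underline r}k_i$, $0\le i\le N$; (4) if $\langle x_\alpha,x_\beta\rangle=0$, then $\varphi([x_\alpha,x_\beta]t^{r_0}t^{\underline r})=[x_\alpha,x_\beta]t^{r_0\frac mK+N(\alpha)+N(\beta)}t^{\underline r}$.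
   Context: $\mathcal G$ is a simple finite dimensional complex Lie algebra with non-degenerate invariant symmetric form $\langle\,,\rangle$. $\pi$ is an automorphism of order $K\in\{1,2,3\}$ induced by a Dynkin diagram automorphism with respect to a Cartan subalgebra $\underline h$; $\epsilon$ is a primitive $K$-th root of unity; $\mathcal G_{[i]}=\{x:\pi x=\epsilon^ix\}$. $\mathcal G_{[0]}$ is simple and $\mathcal G_{[1]},\mathcal G_{[-1]}$ are irreducible contragredient $\mathcal G_{[0]}$-modules. $\underline t\subset\underline h$ is a Cartan subalgebra of $\mathcal G_{[0]}$; $H_j,E_j,F_j$ ($1\le j\le\ell$) are corresponding canonical generators of $\mathcal G_{[0]}$. $E_0$ is a lowest weight vector of $\mathcal G_{[1]}$ and $F_0$ a highest weight vector of $\mathcal G_{[-1]}$, normalized so that $[H_0,E_0]=2E_0$ where $H_0=[E_0,F_0]$. $\psi_1,\dots,\psi_\ell\in\underline t^*$ are the simple roots of $\mathcal G_{[0]}$, $\psi_0\in\underline t^*$ is the lowest weight of $\mathcal G_{[1]}$. $A_{ij}=\psi_j(H_i)$ ($0\le i,j\le\ell$) is an indecomposable affine Cartan matrix, and $(a_0,\dots,a_\ell)$, $(a^1_0,\dots,a^1_\ell)$ are the coprime positive integer vectors with $(A_{ij})(a_0,\dots,a_\ell)^T=0$ and $(a_0^1,\dots,a_\ell^1)(A_{ij})=0$; $a_0=1$ always. The form is normalized by $\langle\psi_0,\psi_0\rangle=2a_0^1/K$ (form on $\underline t^*$ induced from the nonsingular restriction to $\underline t$). Let $m=K\sum_{j=0}^\ell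 a_j$, let $\omega$ be a primitive $m$-th root of unity, and let $\theta$ be the automorphism of $\mathcal G$, of order $m$, with $\theta H_i=H_i$, $\theta E_j=\omega E_j$ ($0\le i,j\le\ell$). Toroidal algebras: $N\ge0$, $A=\mathbb C[t^{\pm1},t_1^{\pm1},\dots,t_N^{\pm1}]$, $t^{\underline r}=t_1^{r_1}\cdots t_N^{r_N}$. For an automorphism $\sigma$ of $\mathcal G$ of order $M$ and a primitive $M$-th root of unity $\rho$: $\Omega_A$ is the free $A$-module with basis $k_0,\dots,k_N$, $d_A$ is the span of the elements $\frac1Mr_0t^{r_0}t^{\underline r}k_0+\sum_{i=1}^Nr_it^{r_0}t^{\underline r}k_i$; $\mathcal G\otimes A\oplus\Omega_A/d_A$ is a Lie algebra with $\Omega_A/d_A$ central and $$[x\otimes t^{r_0}t^{\underline r},y\otimes t^{s_0}t^{\underline s}]=[x,y]\otimes t^{r_0+s_0}t^{\underline r+\underline s}+\tfrac{\langle x,y\rangle}{M}r_0t^{r_0+s_0}t^{\underline r+\underline s}k_0+\langle x,y\rangle\sum_{i=1}^Nr_it^{r_0+s_0}t^{\underline r+\underline s}k_i;$$ $\overline L(\mathcal G,\sigma)$ is its subalgebra $\bigoplus_{i\in\mathbb Z,\underline r\in\mathbb Z^N}\{x:\sigma x=\rho^ix\}\otimes t^it^{\underline r}\oplus(\Omega_A/d_A)_0$, with $(\Omega_A/d_A)_0$ the span of the $t^{r_0}t^{\underline r}k_i$, $r_0\equiv0\ (M)$. This is applied to $(\sigma,M,\rho)=(\pi,K,\epsilon)$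 and $(\theta,m,\omega)$. The integers $N(\alpha)$: let $\mathcal G(\pi)=\bigoplus_i\mathcal G_{[i]}\otimes t^i\oplus\mathbb CC$ with $C$ central and $[x\otimes t^i,y\otimes t^j]=[x,y]\otimes t^{i+j}+\frac{\langle x,y\rangle}{K}i\,\delta_{i+j,0}C$, and $\mathcal G(\theta)=\bigoplus_i\{x:\theta x=\omega^ix\}\otimes t^i\oplus\mathbb CC$ with the same bracket with $\frac1m\langle\,,\rangle$ instead of $\frac1K\langle\,,\rangle$. There is an isomorphism $\mathcal G(\pi)\to\mathcal G(\theta)$ with $E_i\otimes1\mapsto E_i\otimes t$, $F_i\otimes1\mapsto F_i\otimes t^{-1}$ ($1\le i\le\ell$), $E_0\otimes t\mapsto E_0\otimes t$, $F_0\otimes t^{-1}\mapsto F_0\otimes t^{-1}$. It sends each real root vector $x_\alpha\otimes t^{r_0}$ ($0\ne x_\alpha\in\mathcal G_{[r_0]}$ of nonzero $\underline t$-weight $\alpha$) to $x_\alpha\otimes t^{N(\alpha)+\frac mKr_0}$, with $N(\alpha)\in\mathbb Z$ independent of $r_0$; this defines $N(\alpha)$. Throughout, $x_\alpha,x_\beta$ denote such vectors. $\mathbf w$ is the Chevalley involution of $\mathcal G$: the automorphism with $E_j\mapsto-F_j$, $F_j\mapsto-E_j$ ($0\le j\le\ell$). *)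

(* Defs.v *)
From HB Require Import structures.
From mathcomp Require Import all_boot all_order all_algebra.
From mathcomp Require Import perm generic_quotient ring_quotient finmap.
From mathcomp Require Import boolp classical_sets functions cardinality fsbigop.

Set Implicit Arguments.
Unset Strict Implicit.
Unset Printing Implicit Defensive.

Import GRing.Theory Num.Theory.

Local Open Scope ring_scope.
Local Open Scope classical_set_scope.

Section Span.
Variables (F : pzRingType) (V : lmodType F).

Definition lspan (S : set V) : {pred V} := fun v =>
  `[< exists s : seq (F * V),
        (forall p, p \in s -> S p.2) /\ v = \sum_(p <- s) p.1 *: p.2 >].

Lemma lspan_closed (S : set V) : subsemimod_closed (lspan S).
Proof.
split; first split.
- by apply/asboolP; exists [::]; split => //; rewrite big_nil.
- move=> u v /asboolP[s [Ss ->]] /asboolP[s' [Ss' ->]].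
  apply/asboolP; exists (s ++ s'); split; last by rewrite big_cat.
  by move=> p; rewrite mem_cat => /orP[/Ss|/Ss'].
- move=> a v /asboolP[s [Ss ->]].
  apply/asboolP; exists [seq (a * p.1, p.2) | p <- s]; split.
    by move=> _ /mapP[p /Ss Sp ->].
  by rewrite big_map scaler_sumr; apply: eq_bigr => p _; rewrite scalerA.
Qed.
HB.instance Definition _ (S : set V) :=
  GRing.isSubmodClosed.Build F V (lspan S) (lspan_closed S).

Lemma lspan_gen (S : set V) v : S v -> v \in lspan S.
Proof.
move=> Sv; apply/asboolP; exists [:: (1, v)]; split.
  by move=> p; rewrite inE => /eqP ->.
by rewrite big_seq1 scale1r.
Qed.

Variable S : set V.
Local Notation D := (lspan S).
Local Open Scope quotient_scope.

Definition lmod_quot := Quotient.quot D.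
HB.instance Definition _ := GRing.Zmodule.on lmod_quot.

Definition quot_class (v : V) : lmod_quot := \pi_(Quotient.quot D) v.
Definition quot_scale (a : F) (x : lmod_quot) : lmod_quot :=
  quot_class (a *: repr (x : Quotient.quot D)).

Lemma quot_classE u v : quot_class u = quot_class v <-> u - v \in D.
Proof.
rewrite Quotient.idealrBE; split => [|/eqP]; last by [].
by move=> uv; apply/eqP.
Qed.

Lemma quot_classP x : exists v, x = quot_class v.
Proof. by exists (repr (x : Quotient.quot D)); rewrite /quot_class reprK. Qed.

Lemma quot_classD u v : quot_class (u + v) = quot_class u + quot_class v.
Proof. exact: Quotient.pi_add. Qed.

Lemma quot_classZ a v : quot_class (a *: v) = quot_scale a (quot_class v).
Proof.
apply/quot_classE; rewrite -scalerBr rpredZ //; apply/quot_classE.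
by rewrite /quot_class reprK.
Qed.

Fact quot_scaleA a b x : quot_scale a (quot_scale b x) = quot_scale (a * b) x.
Proof. by case: (quot_classP x) => v ->; rewrite -!quot_classZ scalerA. Qed.
Fact quot_scale1 : left_id 1 quot_scale.
Proof. by move=> x; case: (quot_classP x) => v ->; rewrite -quot_classZ scale1r. Qed.
Fact quot_scaleDr : right_distributive quot_scale +%R.
Proof.
move=> a x y; case: (quot_classP x) (quot_classP y) => u -> [v ->].
by rewrite -quot_classD -!quot_classZ -quot_classD scalerDr.
Qed.
Fact quot_scaleDl x : {morph quot_scale^~ x : a b / a + b}.
Proof.
move=> a b; case: (quot_classP x) => v ->.
by rewrite -!quot_classZ -quot_classD scalerDl.
Qed.
HB.instance Definition _ := GRing.Zmodule_isLmodule.Build F lmod_quot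
  quot_scaleA quot_scale1 quot_scaleDr quot_scaleDl.

Fact quot_class_is_linear : linear quot_class.
Proof. by move=> a u v; rewrite quot_classD quot_classZ. Qed.
HB.instance Definition _ :=
  GRing.isLinear.Build F V lmod_quot _ quot_class quot_class_is_linear.

End Span.

(* For [Lam] the group of exponents, [fsupp Lam V] is [V] tensored with the
   group algebra of [Lam]: [single r x] is the element x t^r, and a general
   element is a finite sum of such. *)
Section FinSupp.
Variables (F : pzRingType) (Lam : choiceType) (V : lmodType F).

Definition finsupp_pred : {pred Lam -> V} :=
  fun f => `[< finite_set [set r | f r != 0] >].

Lemma finsupp_closed : subsemimod_closed finsupp_pred.
Proof.
split; first split.
- apply/asboolP; rewrite (_ : [set _ | _] = set0) //.
  by apply/seteqP; split => r //=; rewrite eqxx.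
- move=> f g /asboolP ff /asboolP gf; apply/asboolP.
  have fgf : finite_set ([set r | f r != 0] `|` [set r | g r != 0]).
    by rewrite finite_setU.
  apply: sub_finite_set fgf => r /= fgr.
  case: (eqVneq (f r) 0) => [fr0|]; last by left.
  right; apply: contra_neq fgr => gr0.
  by rewrite [(f + g) r](_ : _ = f r + g r) // fr0 gr0 addr0.
- move=> a f /asboolP ff; apply/asboolP.
  apply: sub_finite_set ff => r /=; apply: contra_neq => fr0.
  by rewrite [(a *: f) r](_ : _ = a *: f r) // fr0 scaler0.
Qed.
HB.instance Definition _ :=
  GRing.isSubmodClosed.Build F (Lam -> V) finsupp_pred finsupp_closed.

Record fsupp := Fsupp { fsupp_fun :> Lam -> V; _ : fsupp_fun \in finsupp_pred }.
HB.instance Definition _ := [isSub for fsupp_fun].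
HB.instance Definition _ := [Choice of fsupp by <:].
HB.instance Definition _ := [SubChoice_isSubLmodule of fsupp by <:].

Fact single_subproof (r : Lam) (x : V) :
  (fun s => if s == r then x else 0) \in finsupp_pred.
Proof.
apply/asboolP; apply: (sub_finite_set _ (finite_set1 r)) => s /=.
by case: (s =P r) => // _; rewrite eqxx.
Qed.
Definition single r x : fsupp := Fsupp (single_subproof r x).

Lemma fsuppP (f g : fsupp) : (forall r, f r = g r) <-> f = g.
Proof. by split => [fg|-> //]; apply: val_inj; apply/funext. Qed.

Lemma fsuppD (f g : fsupp) r : (f + g) r = f r + g r. Proof. by []. Qed.
Lemma fsuppZ a (f : fsupp) r : (a *: f) r = a *: f r. Proof. by []. Qed.
Lemma fsupp0 r : (0 : fsupp) r = 0. Proof. by []. Qed.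
Lemma fsuppN (f : fsupp) r : (- f) r = - f r. Proof. by []. Qed.

Fact single_is_linear r : linear (single r).
Proof.
move=> a x y; apply/fsuppP => s; rewrite fsuppD fsuppZ /=.
by case: eqP; rewrite ?scaler0 ?addr0.
Qed.
HB.instance Definition _ r :=
  GRing.isLinear.Build F V fsupp _ (single r) (single_is_linear r).

Lemma fsupp_bound (f : fsupp) :
  exists A : {fset Lam}, forall r, r \notin A -> f r = 0.
Proof.
case: f => f /= /asboolP /finite_fsetP[A fA]; exists A => r rA.
apply/eqP; apply: contraNT rA => fr0.
by have : [set r | f r != 0] r by []; rewrite fA.
Qed.

Lemma fsupp_sum_eval (A : {fset Lam}) (f : Lam -> fsupp) r :
  (\sum_(i <- A) f i) r = \sum_(i <- A) f i r.
Proof. by elim/big_rec2: _ => // i x y _ <-; rewrite fsuppD. Qed.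

Lemma fsuppE (f : fsupp) (A : {fset Lam}) :
  (forall r, r \notin A -> f r = 0) -> f = \sum_(r <- A) single r (f r).
Proof.
move=> fA; apply/fsuppP => s; rewrite fsupp_sum_eval /=.
have [sA|sA] := boolP (s \in A).
  rewrite (big_fsetD1 s) //= eqxx big_seq big1 ?addr0 // => r.
  by rewrite !inE eq_sym => /andP[/negPf ->].
rewrite fA // big_seq big1 // => r rA; case: eqP => // sr.
by rewrite -sr (negPf sA) in rA.
Qed.

Lemma fsupp_ind (P : fsupp -> Prop) :
  P 0 -> (forall f g, P f -> P g -> P (f + g)) -> (forall r x, P (single r x)) ->
  forall f, P f.
Proof.
move=> P0 PD P1 f; have [A /fsuppE ->] := fsupp_bound f.
by apply: big_ind => // r _; exact: P1.
Qed.

End FinSupp.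
Arguments single {F Lam V}.

HB.mixin Record Lmodule_isLieAlgebra (F : comPzRingType) L
    of GRing.Lmodule F L := {
  lie : L -> L -> L;
  lie_linearl : forall y, linear (lie^~ y);
  lie_linearr : forall x, linear (lie x);
  liexx : forall x, lie x x = 0;
  lie_jacobi : forall x y z,
    lie x (lie y z) + lie y (lie z x) + lie z (lie x y) = 0
}.

#[short(type="lieAlgType")]
HB.structure Definition LieAlgebra (F : comPzRingType) :=
  { L of Lmodule_isLieAlgebra F L & GRing.Lmodule F L }.

#[short(type="finLieAlgType")]
HB.structure Definition FinLieAlgebra (F : comNzRingType) :=
  { L of LieAlgebra F L & Vector F L }.

Section LieTheory.
Variables (F : comPzRingType) (L : lieAlgType F).
Implicit Types x y z : L.

Lemma lieDl x y z : lie (x + y) z = lie x z + lie y z.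
Proof. by have := lie_linearl z 1 x y; rewrite !scale1r. Qed.
Lemma lieDr x y z : lie x (y + z) = lie x y + lie x z.
Proof. by have := lie_linearr x 1 y z; rewrite !scale1r. Qed.
Lemma lie0l x : lie 0 x = 0.
Proof. by apply: (addIr (lie 0 x)); rewrite -lieDl !add0r. Qed.
Lemma lie0r x : lie x 0 = 0.
Proof. by apply: (addIr (lie x 0)); rewrite -lieDr !add0r. Qed.
Lemma lieZl a x y : lie (a *: x) y = a *: lie x y.
Proof. by have := lie_linearl y a x 0; rewrite lie0l !addr0. Qed.
Lemma lieZr a x y : lie x (a *: y) = a *: lie x y.
Proof. by have := lie_linearr x a y 0; rewrite lie0r !addr0. Qed.
Lemma lieC x y : lie x y = - lie y x.
Proof.
apply/eqP; rewrite -addr_eq0; apply/eqP.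
by have := liexx (x + y); rewrite lieDl !lieDr !liexx add0r addr0.
Qed.
End LieTheory.

Definition lie_subalgebra (F : comPzRingType) (L : lieAlgType F)
    (S : set L) : Prop :=
  [/\ S 0, forall a x y, S x -> S y -> S (a *: x + y)
    & forall x y, S x -> S y -> S (lie x y)].

(* Isomorphisms between Lie subalgebras [S] of [L] and [S'] of [L']: only the
   values of [phi] on [S] matter. *)
Section LieIso.
Variables (F : comPzRingType) (L L' : lieAlgType F).

Definition linear_on (S : set L) (phi : L -> L') : Prop :=
  forall a x y, S x -> S y -> phi (a *: x + y) = a *: phi x + phi y.

Definition lie_isomorphism (S : set L) (S' : set L') (phi : L -> L') : Prop :=
  [/\ lie_subalgebra S, lie_subalgebra S', set_bij S S' phi, linear_on S phi
    & forall x y, S x -> S y -> phi (lie x y) = lie (phi x) (phi y)].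
End LieIso.

Record invForm (F : comNzRingType) (G : lieAlgType F) := InvForm {
  inv_form :> {biscalar G};
  inv_formC : forall x y, inv_form x y = inv_form y x;
  inv_form_lie : forall x y z, inv_form (lie x y) z = inv_form x (lie y z)
}.

Definition nondegenerate_on (F : comNzRingType) (G : lieAlgType F)
    (B : invForm G) (S : {pred G}) : Prop :=
  forall x, x \in S -> (forall y, y \in S -> B x y = 0) -> x = 0.

Record cocycle (F : pzRingType) (Lam : zmodType) (Z : lmodType F) := Cocycle {
  cocycle_fun :> Lam -> Lam -> Z;
  cocyclexx : forall r, cocycle_fun r r = 0;
  cocycleC : forall r s, cocycle_fun r s = - cocycle_fun s r;
  cocycle_cyclic : forall r s u,
    cocycle_fun (r + s) u + cocycle_fun (s + u) r + cocycle_fun (u + r) s = 0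
}.

(* Carries below the bracket
   [x t^r, y t^s] = [x, y] t^(r+s) + <x, y> kappa r s, with Z central: the affine
   and the toroidal algebras are instances. [B] and [kappa] occur in the type
   only to determine this bracket. *)
Definition loop_ext_of (F : comNzRingType) (G : lieAlgType F) (B : invForm G)
  (Lam : zmodType) (Z : lmodType F) (kappa : cocycle Lam Z) : Type :=
  (fsupp Lam G * Z)%type.

Section LoopExtension.
Variables (F : comNzRingType) (G : lieAlgType F) (B : invForm G).
Variables (Lam : zmodType) (Z : lmodType F) (kappa : cocycle Lam Z).

Local Notation loop_ext := (loop_ext_of B kappa).

HB.instance Definition _ := GRing.Lmodule.copy loop_ext (fsupp Lam G * Z)%type.

Definition loop_elt (r : Lam) (x : G) : loop_ext := (single r x, 0).
Definition central_elt (z : Z) : loop_ext := (0, z).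

Definition loop_term (f g : fsupp Lam G) (r s : Lam) : loop_ext :=
  (single (r + s) (lie (f r) (g s)), B (f r) (g s) *: kappa r s).

Definition loop_lie (u v : loop_ext) : loop_ext :=
  \sum_(r \in [set: Lam]) \sum_(s \in [set: Lam]) loop_term u.1 v.1 r s.

Let fst_lin a (u v : loop_ext) : (a *: u + v).1 = a *: u.1 + v.1.
Proof. by []. Qed.

Lemma loop_term0l (f g : fsupp Lam G) r s : f r = 0 -> loop_term f g r s = 0.
Proof.
by move=> f0; rewrite /loop_term f0 lie0l linear0 linear0l scale0r.
Qed.

Lemma loop_term0r (f g : fsupp Lam G) r s : g s = 0 -> loop_term f g r s = 0.
Proof.
by move=> g0; rewrite /loop_term g0 lie0r linear0 linear0r scale0r.
Qed.

Lemma loop_lieE (P Q : {fset Lam}) (u v : loop_ext) :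
  (forall r, r \notin P -> u.1 r = 0) -> (forall r, r \notin Q -> v.1 r = 0) ->
  loop_lie u v = \sum_(r <- P) \sum_(s <- Q) loop_term u.1 v.1 r s.
Proof.
move=> uP vQ.
have inner r : \sum_(s \in [set: Lam]) loop_term u.1 v.1 r s =
    \sum_(s <- Q) loop_term u.1 v.1 r s.
  by apply: fsbigTE => s /vQ; apply: loop_term0r.
rewrite /loop_lie (fsbigTE P) => [|r /uP ur].
  by apply: eq_bigr => r _.
by rewrite inner big1 // => s _; apply: loop_term0l.
Qed.

Fact loop_lie_linearl v : linear (loop_lie^~ v).
Proof.
move=> a u u'; have [P uP] := fsupp_bound u.1.
have [P' uP'] := fsupp_bound u'.1; have [Q vQ] := fsupp_bound v.1.
pose PP := (P `|` P')%fset.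
have uPP r : r \notin PP -> u.1 r = 0.
  by rewrite inE negb_or => /andP[/uP].
have uPP' r : r \notin PP -> u'.1 r = 0.
  by rewrite inE negb_or => /andP[_ /uP'].
rewrite !(loop_lieE (P := PP) (Q := Q)) //; last first.
  by move=> r rPP; rewrite fst_lin fsuppD fsuppZ uPP // uPP' // scaler0 addr0.
rewrite scaler_sumr -big_split /=; apply: eq_bigr => r _.
rewrite scaler_sumr -big_split /=; apply: eq_bigr => s _.
rewrite /loop_term fsuppD fsuppZ lieDl lieZl linearP linearPl /=.
by rewrite scalerDl -scalerA.
Qed.

Fact loop_lie_linearr u : linear (loop_lie u).
Proof.
move=> a v v'; have [P vP] := fsupp_bound v.1.
have [P' vP'] := fsupp_bound v'.1; have [Q uQ] := fsupp_bound u.1.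
pose PP := (P `|` P')%fset.
have vPP r : r \notin PP -> v.1 r = 0.
  by rewrite inE negb_or => /andP[/vP].
have vPP' r : r \notin PP -> v'.1 r = 0.
  by rewrite inE negb_or => /andP[_ /vP'].
rewrite !(loop_lieE (P := Q) (Q := PP)) //; last first.
  by move=> r rPP; rewrite fst_lin fsuppD fsuppZ vPP // vPP' // scaler0 addr0.
rewrite scaler_sumr -big_split /=; apply: eq_bigr => r _.
rewrite scaler_sumr -big_split /=; apply: eq_bigr => s _.
rewrite /loop_term fsuppD fsuppZ lieDr lieZr linearP linearPr /=.
by rewrite scalerDl -scalerA.
Qed.

Lemma loop_lie_elt r s x y : loop_lie (loop_elt r x) (loop_elt s y) =
  loop_elt (r + s) (lie x y) + central_elt (B x y *: kappa r s).
Proof.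
rewrite (loop_lieE (P := [fset r]%fset) (Q := [fset s]%fset)) /=; first last.
- by move=> u; rewrite inE => /negPf ->.
- by move=> u; rewrite inE => /negPf ->.
rewrite !big_seq_fset1 /loop_term /= !eqxx.
by rewrite /loop_elt /central_elt; congr pair; rewrite /= ?addr0 ?add0r.
Qed.

Lemma loop_lie_centrall z v : loop_lie (central_elt z) v = 0.
Proof.
have [Q vQ] := fsupp_bound v.1.
by rewrite (loop_lieE (P := fset0) (Q := Q)) // big_seq_fset0.
Qed.

Lemma loop_lie_centralr u z : loop_lie u (central_elt z) = 0.
Proof.
have [Q uQ] := fsupp_bound u.1.
rewrite (loop_lieE (P := Q) (Q := fset0)) // big1 // => r _.
by rewrite big_seq_fset0.
Qed.

Lemma loop_ext_ind (P : loop_ext -> Prop) :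
  (forall u v, P u -> P v -> P (u + v)) -> (forall r x, P (loop_elt r x)) ->
  (forall z, P (central_elt z)) -> forall u, P u.
Proof.
move=> PD Pl Pc [f z].
have -> : (f, z) = ((f, 0) : loop_ext) + central_elt z.
  by congr pair; rewrite /= ?addr0 ?add0r.
apply: (PD) => //; elim/fsupp_ind: f => [|f g Pf Pg|r x]; first exact: (Pc 0).
  have -> : (f + g, 0) = ((f, 0) : loop_ext) + ((g, 0) : loop_ext).
    by congr pair; rewrite /= ?addr0.
  exact: PD.
exact: Pl.
Qed.

Let lD x y z : loop_lie (x + y) z = loop_lie x z + loop_lie y z.
Proof. by have := loop_lie_linearl z 1 x y; rewrite !scale1r. Qed.
Let rD x y z : loop_lie x (y + z) = loop_lie x y + loop_lie x z.
Proof. by have := loop_lie_linearr x 1 y z; rewrite !scale1r. Qed.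

Let eltD r x y : loop_elt r (x + y) = loop_elt r x + loop_elt r y.
Proof. by rewrite /loop_elt linearD; congr pair; rewrite /= addr0. Qed.
Let eltN r x : loop_elt r (- x) = - loop_elt r x.
Proof. by rewrite /loop_elt linearN; congr pair; rewrite /= oppr0. Qed.
Let celtD x y : central_elt (x + y) = central_elt x + central_elt y.
Proof. by congr pair; rewrite /= addr0. Qed.
Let celtN x : central_elt (- x) = - central_elt x.
Proof. by congr pair; rewrite /= oppr0. Qed.

Fact loop_lieC u v : loop_lie u v = - loop_lie v u.
Proof.
elim/loop_ext_ind: u => [u u' IHu IHu'|r x|z]; last 1 first.
- by rewrite loop_lie_centrall loop_lie_centralr oppr0.
- by rewrite lD rD opprD IHu IHu'.
elim/loop_ext_ind: v => [v v' IHv IHv'|s y|z]; last 1 first.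
- by rewrite loop_lie_centrall loop_lie_centralr oppr0.
- by rewrite lD rD opprD IHv IHv'.
rewrite !loop_lie_elt lieC cocycleC (inv_formC B) [s + r]addrC eltN.
by rewrite scalerN celtN opprD.
Qed.

Fact loop_liexx u : loop_lie u u = 0.
Proof.
elim/loop_ext_ind: u => [u v IHu IHv|r x|z]; last exact: loop_lie_centrall.
  by rewrite lD !rD IHu IHv add0r addr0 loop_lieC addNr.
rewrite loop_lie_elt liexx cocyclexx scaler0.
by rewrite /loop_elt /central_elt linear0; congr pair; rewrite /= addr0.
Qed.

Fact loop_lie_jacobi u v w :
  loop_lie u (loop_lie v w) + loop_lie v (loop_lie w u)
    + loop_lie w (loop_lie u v) = 0.
Proof.
have add3 (a b c a' b' c' : loop_ext) : a + b + c = 0 -> a' + b' + c' = 0 ->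
    (a + a') + (b + b') + (c + c') = 0.
  by move=> e e'; rewrite (addrACA a a' b b') [LHS]addrACA e e' addr0.
have l0 x : loop_lie 0 x = 0 by rewrite (loop_lie_centrall 0).
have r0 x : loop_lie x 0 = 0 by rewrite (loop_lie_centralr x 0).
pose cE := (loop_lie_centrall, loop_lie_centralr, l0, r0, addr0).
elim/loop_ext_ind: u => [u u' IHu IHu'|r x|z]; last by rewrite !cE.
  by rewrite !(lD, rD); apply: add3.
elim/loop_ext_ind: v => [v v' IHv IHv'|s y|z]; last by rewrite !cE.
  by rewrite !(lD, rD); apply: add3.
elim/loop_ext_ind: w => [w w' IHw IHw'|q z|z]; last by rewrite !cE.
  by rewrite !(lD, rD); apply: add3.
rewrite !loop_lie_elt !rD !loop_lie_elt !loop_lie_centralr !addr0.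
have -> : B x (lie y z) = B (lie x y) z by rewrite (inv_form_lie B).
have -> : B y (lie z x) = B (lie x y) z.
  by rewrite -(inv_form_lie B) (inv_formC B) (inv_form_lie B).
rewrite [B z _]inv_formC.
have cyc : loop_elt (r + (s + q)) (lie x (lie y z)) +
    loop_elt (s + (q + r)) (lie y (lie z x)) +
    loop_elt (q + (r + s)) (lie z (lie x y)) = 0.
  have -> : s + (q + r) = r + (s + q) by rewrite addrA addrC.
  have -> : q + (r + s) = r + (s + q) by rewrite addrC -addrA.
  by rewrite -!eltD lie_jacobi /loop_elt linear0.
set b := B (lie x y) z.
have ccyc : central_elt (b *: kappa r (s + q)) +
    central_elt (b *: kappa s (q + r)) + central_elt (b *: kappa q (r + s)) = 0.
  rewrite -!celtD -!scalerDr cocycleC [kappa s _]cocycleC [kappa q _]cocycleC.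
  rewrite -!opprD [X in - X](_ : _ = 0) ?oppr0 ?scaler0 //.
  by rewrite -[RHS](cocycle_cyclic kappa r s q) addrC addrA.
rewrite [X in X + _]addrACA [LHS]addrACA; exact/etrans/addr0/(f_equal2 +%R).
Qed.

HB.instance Definition _ := Lmodule_isLieAlgebra.Build F loop_ext
  loop_lie_linearl loop_lie_linearr loop_liexx loop_lie_jacobi.

Lemma lie_loop_elt r s x y : lie (loop_elt r x) (loop_elt s y) =
  loop_elt (r + s) (lie x y) + central_elt (B x y *: kappa r s).
Proof. exact: loop_lie_elt. Qed.

Lemma lie_central z v : lie (central_elt z) v = 0.
Proof. exact: loop_lie_centrall. Qed.

End LoopExtension.

Fact addr_cyclic (V : nmodType) (a b c : V) :
  a + b + (b + c) + (c + a) = (a + b + c) + (a + b + c).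
Proof. by rewrite -[LHS]addrA [b + c + _]addrC -!addrA. Qed.

Section Affine.
Variables (F : fieldType) (M : nat).

Definition affine_cocycle_fun (i j : int) : F^o :=
  if i + j == 0 then i%:~R / M%:R else 0.

Fact affine_cocyclexx i : affine_cocycle_fun i i = 0.
Proof.
rewrite /affine_cocycle_fun -mulr2n mulrn_eq0 /=.
by case: eqP => // ->; rewrite mul0r.
Qed.
Fact affine_cocycleC i j : affine_cocycle_fun i j = - affine_cocycle_fun j i.
Proof.
rewrite /affine_cocycle_fun [j + i]addrC; case: eqP => [|_]; rewrite ?oppr0 //.
by move=> /eqP; rewrite addr_eq0 => /eqP ->; rewrite rmorphN mulNr.
Qed.
Fact affine_cocycle_cyclic i j k :
  affine_cocycle_fun (i + j) k + affine_cocycle_fun (j + k) i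
    + affine_cocycle_fun (k + i) j = 0.
Proof.
rewrite /affine_cocycle_fun.
have -> : j + k + i = i + j + k by rewrite addrC addrA.
have -> : k + i + j = i + j + k by rewrite -addrA addrC.
case: eqP => [ijk|_]; rewrite ?addr0 // -!mulrDl -!rmorphD /=.
by rewrite addr_cyclic ijk mul0r.
Qed.
Definition affine_cocycle : cocycle int F^o :=
  Cocycle affine_cocyclexx affine_cocycleC affine_cocycle_cyclic.

Variables (G : lieAlgType F) (B : invForm G).

(* G (x) F[t, t^-1] + F C, with C = central_elt _ 1 *)
Definition affine : lieAlgType F := loop_ext_of B affine_cocycle.
End Affine.

Section Toroidal.
Variables (F : numFieldType) (M N : nat).

(* exponents (r_0, (r_1, ..., r_N)) *)
Definition texp : Type := (int * 'rV[int]_N)%type.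
HB.instance Definition _ := GRing.Zmodule.on texp.

(* Omega_A: the coordinate [i : 'I_N.+1] of a row vector is the coefficient
   of k_i. *)
Definition Omega : lmodType F := fsupp texp 'rV[F]_N.+1.

Definition k_ (i : 'I_N.+1) : 'rV[F]_N.+1 := delta_mx 0 i.

(* (r_0 / M) k_0 + r_1 k_1 + ... + r_N k_N *)
Definition dlog (r : texp) : 'rV[F]_N.+1 :=
  (r.1%:~R / M%:R) *: k_ ord0 + \sum_(i < N) (r.2 0 i)%:~R *: k_ (lift ord0 i).

Definition dA_gen : set Omega := [set single r (dlog r) | r in [set: texp]].

Definition OmegadA : lmodType F := lmod_quot dA_gen.

Definition toroidal_cocycle_fun (r s : texp) : OmegadA :=
  quot_class dA_gen (single (r + s) (dlog r)).

Lemma dlogD r s : dlog (r + s) = dlog r + dlog s.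
Proof.
rewrite /dlog addrACA -scalerDl -mulrDl -rmorphD -big_split /=; congr (_ + _).
by apply: eq_bigr => i _; rewrite mxE rmorphD scalerDl.
Qed.

Lemma dA_eq0 r : quot_class dA_gen (single r (dlog r)) = 0.
Proof.
rewrite -[RHS](linear0 (quot_class dA_gen)); apply/quot_classE.
by rewrite subr0; apply: lspan_gen; exists r.
Qed.

Fact toroidal_cocycleC r s :
  toroidal_cocycle_fun r s = - toroidal_cocycle_fun s r.
Proof.
apply/eqP; rewrite -addr_eq0 /toroidal_cocycle_fun [s + r]addrC -!linearD /=.
by rewrite -dlogD dA_eq0.
Qed.
Fact toroidal_cocyclexx r : toroidal_cocycle_fun r r = 0.
Proof.
have /eqP := toroidal_cocycleC r r; rewrite -addr_eq0 -mulr2n -scaler_nat.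
by rewrite scaler_eq0 pnatr_eq0 => /eqP.
Qed.
Fact toroidal_cocycle_cyclic r s u :
  toroidal_cocycle_fun (r + s) u + toroidal_cocycle_fun (s + u) r
    + toroidal_cocycle_fun (u + r) s = 0.
Proof.
rewrite /toroidal_cocycle_fun.
have -> : s + u + r = r + s + u by rewrite addrC addrA.
have -> : u + r + s = r + s + u by rewrite -addrA addrC.
rewrite -!linearD /= -!dlogD addr_cyclic.
by rewrite dlogD [single _ _]linearD [LHS]linearD /= !dA_eq0 addr0.
Qed.
Definition toroidal_cocycle : cocycle texp OmegadA :=
  Cocycle toroidal_cocyclexx toroidal_cocycleC toroidal_cocycle_cyclic.

Variables (G : lieAlgType F) (B : invForm G).

Definition toroidal : lieAlgType F := loop_ext_of B toroidal_cocycle.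

Definition tor_elt (x : G) (r0 : int) (r : 'rV[int]_N) : toroidal :=
  loop_elt B toroidal_cocycle (r0, r) x.

(* the class of t^r0 t^r k_i *)
Definition tor_k (r0 : int) (r : 'rV[int]_N) (i : 'I_N.+1) : toroidal :=
  central_elt B toroidal_cocycle (quot_class dA_gen (single (r0, r) (k_ i))).

Lemma lie_tor_elt x y (r0 s0 : int) (r s : 'rV[int]_N) :
  lie (tor_elt x r0 r) (tor_elt y s0 s) =
    tor_elt (lie x y) (r0 + s0) (r + s)
    + (B x y / M%:R * r0%:~R) *: tor_k (r0 + s0) (r + s) ord0
    + B x y *: \sum_(i < N) (r 0 i)%:~R *: tor_k (r0 + s0) (r + s) (lift ord0 i).
Proof.
rewrite /tor_elt lie_loop_elt -addrA; congr (_ + _).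
pose g (v : 'rV[F]_N.+1) : toroidal := central_elt B toroidal_cocycle
  (quot_class dA_gen (single ((r0 + s0, r + s) : texp) v)).
have gD v w : g (v + w) = g v + g w.
  by rewrite /g !linearD; congr pair; rewrite /= addr0.
have gZ a v : g (a *: v) = a *: g v.
  by rewrite /g !linearZ; congr pair; rewrite /= scaler0.
have g0 : g 0 = 0 by rewrite /g !linear0.
transitivity (g (B x y *: dlog (r0, r))).
  by rewrite /g !linearZ.
rewrite gZ gD gZ scalerDr scalerA -mulrA [M%:R^-1 * _]mulrC; congr (_ + _ *: _).
elim/big_rec2: _ => // i u v _ <-.
by rewrite gD gZ.
Qed.

End Toroidal.
Arguments dA_gen F M N _ : clear implicits.

Section FinDim.
Variables (F : fieldType) (G : finLieAlgType F).
Implicit Types S T I V W h : {vspace G}.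

Definition subalgebra S : Prop := {in S &, forall x y, lie x y \in S}.

Definition ideal_of S I : Prop :=
  (I <= S)%VS /\ forall x y, x \in S -> y \in I -> lie x y \in I.

(* For the whole algebra, take [S] to be [fullv] *)
Definition simple_lie S : Prop :=
  [/\ subalgebra S, exists x y, [/\ x \in S, y \in S & lie x y != 0]
    & forall I, ideal_of S I -> I = 0%VS \/ I = S].

Definition nilpotent_lie S : Prop :=
  exists n, forall (xs : n.-tuple G) y,
    {subset xs <= S} -> y \in S -> foldr lie y xs = 0.

Definition cartan_subalgebra S h : Prop :=
  [/\ (h <= S)%VS, subalgebra h, nilpotent_lie h
    & forall x, x \in S -> (forall y, y \in h -> lie x y \in h) -> x \in h].

Definition automorphism (f : 'End(G)) : Prop :=
  bijective f /\ {morph f : x y / lie x y}.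

Definition has_order (f : G -> G) (n : nat) : Prop :=
  [/\ (0 < n)%N, iter n f =1 id
    & forall k, (0 < k)%N -> iter k f =1 id -> (n <= k)%N].

Definition graded (sigma : 'End(G)) (rho : F) (i : int) : {vspace G} :=
  passmx.leigenspace sigma (rho ^ i).

Definition dual h := 'Hom(subvs_of h, F^o).

Definition weight_vector h (al : dual h) (x : G) : Prop :=
  forall y : subvs_of h, lie (vsval y) x = (al y : F) *: x.

Definition is_root S h (al : dual h) : Prop :=
  al != 0 /\ exists x, [/\ x \in S, x != 0 & weight_vector al x].

Definition simple_roots S h n (al : 'I_n -> dual h) : Prop :=
  [/\ free [seq al i | i : 'I_n], forall i, is_root S (al i)
    & forall be, is_root S be -> exists c : 'I_n -> nat,
        be = \sum_i al i *+ c i \/ be = - \sum_i al i *+ c i].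

(* [al j (H i)] is the (i, j) entry of the Cartan matrix. That [E i] and [F' j]
   commute for i <> j is not required separately: al i - al j is not a root. *)
Definition canonical_generators S h n (al : 'I_n -> dual h)
    (H : 'I_n -> subvs_of h) (E F' : 'I_n -> G) : Prop :=
  [/\ cartan_subalgebra S h, simple_roots S al,
      forall i, [/\ E i \in S, F' i \in S,
        weight_vector (al i) (E i) & weight_vector (- al i) (F' i)],
      forall i, lie (E i) (F' i) = vsval (H i) /\ al i (H i) = 2
    & forall T, subalgebra T -> (forall i, E i \in T /\ F' i \in T) ->
        (S <= T)%VS].

Definition induced_by_diagram h (f : 'End(G)) : Prop :=
  exists n (al : 'I_n -> dual h) H E F' (s : 'S_n),
    [/\ canonical_generators fullv al H E F',
        forall i j, al (s j) (H (s i)) = al j (H i)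
      & forall i, f (E i) = E (s i) /\ f (F' i) = F' (s i)].

Definition submodule S V W : Prop :=
  (W <= V)%VS /\ forall x v, x \in S -> v \in W -> lie x v \in W.

Definition irreducible_module S V : Prop :=
  [/\ V <> 0%VS, submodule S V V
    & forall W, submodule S V W -> W = 0%VS \/ W = V].

(* An invariant pairing identifies each of V and W with the dual of the other *)
Definition contragredient_modules S V W : Prop :=
  exists b : {biscalar G},
    [/\ forall x v w, x \in S -> v \in V -> w \in W ->
          b (lie x v) w = - b v (lie x w),
        forall v, v \in V -> (forall w, w \in W -> b v w = 0) -> v = 0
      & forall w, w \in W -> (forall v, v \in V -> b v w = 0) -> w = 0].

Variable B : invForm G.

Definition dual_vec h (la : dual h) : subvs_of h :=
  xget 0 [set z | forall y : subvs_of h, la y = B (vsval z) (vsval y)].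

Definition dual_form h (la mu : dual h) : F :=
  B (vsval (dual_vec la)) (vsval (dual_vec mu)).

(* sum_i graded sigma rho i (x) t^i + F C *)
Definition affine_sub (M : nat) (sigma : 'End(G)) (rho : F) :
    set (affine M B) :=
  [set u : affine M B | forall i, u.1 i \in graded sigma rho i].

(* The element x of G has t-weight al <> 0 and x t^r0 is a real root vector. *)
Definition root_vector (sigma : 'End(G)) (rho : F) h (al : dual h) (x : G)
    (r0 : int) : Prop :=
  [/\ al != 0, x != 0, x \in graded sigma rho r0 & weight_vector al x].

End FinDim.
Arguments affine_sub {F G} B M sigma rho _.

Definition aff_elt (F : fieldType) (M : nat) (G : lieAlgType F) (B : invForm G)
    (x : G) (i : int) : affine M B :=
  loop_elt B (affine_cocycle F M) i x.

(* The Lie algebra "L-bar" of sigma, an automorphism of order M, and of rho, a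
   primitive M-th root of unity. *)
Definition Lbar (F : numFieldType) (G : finLieAlgType F) (B : invForm G)
    (M N : nat) (sigma : 'End(G)) (rho : F) : set (toroidal M N B) :=
  [set u : toroidal M N B | (forall r, u.1 r \in graded sigma rho r.1) /\
     u.2 \in lspan [set z | exists r i, (M%:Z %| r.1)%Z /\
                      z = quot_class (dA_gen F M N) (single r (k_ F i))]].
Arguments Lbar {F G} B M N sigma rho _.

Section Cartan.
Variables (n : nat) (A : 'M[int]_n).

Definition gen_cartan_matrix : Prop :=
  [/\ forall i, A i i = 2, forall i j, i != j -> A i j <= 0
    & forall i j, A i j = 0 -> A j i = 0].

Definition indecomposable_mx : Prop :=
  forall I : {set 'I_n}, I != finset.set0 -> I != [set: 'I_n]%SET ->
    exists i j, [/\ i \in I, j \notin I & A i j != 0].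

Definition affine_type (R : realFieldType) : Prop :=
  let AR := map_mx intr A : 'M[R]_n in
  [/\ \rank AR = n.-1,
      exists u : 'cV[R]_n, (forall i, 0 < u i 0) /\ AR *m u = 0
    & forall v : 'cV[R]_n, (forall i, 0 <= (AR *m v) i 0) -> AR *m v = 0].

Definition affine_cartan_matrix (R : realFieldType) : Prop :=
  [/\ gen_cartan_matrix, indecomposable_mx & affine_type R].
End Cartan.

Definition coprime_positive n (a : 'I_n -> nat) : Prop :=
  (forall i, (0 < a i)%N) /\ \big[gcdn/0%N]_i a i = 1%N.

Section Formulas.
Variables (F : numFieldType) (G : finLieAlgType F) (B : invForm G).
Variables (K m N : nat) (pi w : 'End(G)) (eps : F).
Variables (t : {vspace G}) (NN : dual t -> int).

(* x is one of the vectors x_al *)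
Definition is_x (al : dual t) (x : G) : Prop := exists s, root_vector pi eps al x s.

(* Only vectors of L-bar are constrained; the four clauses overlap. *)
Definition formulas (phi : toroidal K N B -> toroidal m N B) : Prop :=
  let L := Lbar B K N pi eps in
  let q : int := (m %/ K)%N in
  [/\ forall al x r0 r, is_x al x -> L (tor_elt K B x r0 r) ->
        phi (tor_elt K B x r0 r) = tor_elt m B x (r0 * q + NN al) r,
      forall al x r0 r, is_x al x ->
        let h := lie x (w x) in L (tor_elt K B h r0 r) ->
        phi (tor_elt K B h r0 r) = tor_elt m B h (r0 * q) r
          + (B x (w x) * ((NN al)%:~R / m%:R)) *: tor_k m B (r0 * q) r ord0,
      forall r0 r i, L (tor_k K B r0 r i) ->
        phi (tor_k K B r0 r i) = tor_k m B (r0 * q) r i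
    & forall al be x y r0 r, is_x al x -> is_x be y -> B x y = 0 ->
        L (tor_elt K B (lie x y) r0 r) ->
        phi (tor_elt K B (lie x y) r0 r) =
          tor_elt m B (lie x y) (r0 * q + NN al + NN be) r].
End Formulas.

(* Main.v *)
Require Import Defs.
From HB Require Import structures.
From mathcomp Require Import all_boot all_order all_algebra.
From mathcomp Require Import finmap.
From mathcomp Require Import boolp classical_sets functions cardinality fsbigop.
From mathcomp Require Import reals complex.
From mathcomp Require Import ring.
From mathcomp Require Import spectral.

Set Implicit Arguments.
Unset Strict Implicit.
Unset Printing Implicit Defensive.

Import GRing.Theory Num.Theory.
Local Open Scope ring_scope.

(** The integers N(alpha) come from one element X of t: choose X with
   psi_j(X) = 1 for j >= 1. The relation sum_j a_j psi_j = 0 on t and a_0 = 1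
   then give psi_0(X) = 1 - q with q = m / K, so that the derivation
   ad X + q t d/dt takes each of the elements E_j, E_0 t to 1 times itself and
   the F_j, F_0 t^-1 to -1 times themselves. These are the degrees in t of their
   images under the given isomorphism of affine algebras, and since G_[0] is
   generated by the E_j and F_j, and G_[1], G_[-1] by E_0, F_0 as modules, that
   isomorphism carries the derivation to t d/dt; hence N(alpha) = alpha(X)
   ([Nal_X]).

   For [X, x] = j x put
     phi(x t^r0 t^r) = x t^(q r0 + j) t^r + (B(x, X) / m) t^(q r0) t^r k_0,
     phi(t^r0 t^r k_i) = t^(q r0) t^r k_i.
   The correction vanishes unless j = 0. This respects the bracket of the whole
   toroidal algebras: for [X, x] = j x and [X, y] = - j y the shift j adds
   (j / m) B(x, y) k_0 to the cocycle, and B([x, y], X) = j B(x, y)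
   ([twist_lie]). The formulas of the theorem are special cases, because
   B([x, w x], X) = alpha(X) B(x, w x) for x of weight alpha
   ([twist_formulas]).

   What remains is the structure of G. It has a basis of root vectors and of
   brackets of opposite root vectors, since these span an ideal
   ([root_gen_span]), and on such a basis ad X has integral eigenvalues and pi
   and theta act by known scalars, which identifies the image of phi
   ([twist_isomorphism]). The center is respected because pi and theta preserve
   B ([schur_form], [form_preserved]). For uniqueness, a bracket [x, y] of
   opposite root vectors with B(x, y) <> 0 is a multiple of some [u, w u] with
   B(u, w u) <> 0: the form B(-, w -) is symmetric and does not vanish on
   the root vectors of the weight of x ([exists_coroot],
   [bracket_proportional]). *)

(** * Bases, functionals and linear maps on finite sums *)

Section LinearAlgebra.
Variables (F : fieldType) (V : vectType F).

(** The hypotheses on simplicity, irreducibility and generation quantify over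
   objects of type [{vspace V}]; this lets them be applied to a subspace given
   by a predicate. A subspace of largest dimension inside P is all of P. *)
Lemma vspace_of_closed (P : V -> Prop) :
  P 0 -> (forall a x y, P x -> P y -> P (a *: x + y)) ->
  exists W : {vspace V}, forall x, x \in W <-> P x.
Proof.
move=> P0 PD.
pose Q n :=
  `[< exists W : {vspace V}, \dim W = n /\ forall x, x \in W -> P x >].
have exQ : exists n, Q n.
  exists 0%N; apply/asboolP; exists 0%VS; rewrite dimv0; split=> // x.
  by rewrite memv0 => /eqP ->.
have Qmax n : Q n -> (n <= \dim {:V})%N.
  by move=> /asboolP[W [<- _]]; rewrite dimvS ?subvf.
have [_ /asboolP[W [<- WP]] Wmax] := ex_maxnP exQ Qmax.
exists W => x; split=> [/WP //|Px].
have /Wmax : Q (\dim (W + <[x]>)%VS).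
  apply/asboolP; exists (W + <[x]>)%VS; split=> // y.
  move=> /memv_addP[u Wu [v /vlineP[c ->] ->]].
  by rewrite addrC; apply: PD => //; apply: WP.
move=> le_dim; have /eqP WE : W == (W + <[x]>)%VS by rewrite eqEdim addvSl.
by rewrite WE memvE addvSr.
Qed.

(** A free family in S of largest size. *)
Lemma basis_of_span (S : set V) : (forall x, x \in lspan S) ->
  exists n, exists2 b : n.-tuple V, basis_of fullv b & forall i, S (tnth b i).
Proof.
move=> spanS.
pose Q n := `[< exists X : seq V, [/\ size X = n, free X
                                   & forall x, x \in X -> S x] >].
have exQ : exists n, Q n.
  by exists 0%N; apply/asboolP; exists [::]; split=> //; apply: nil_free.
have Qmax n : Q n -> (n <= \dim {:V})%N.
  move=> /asboolP[X [<- /eqP <- _]]; exact/dimvS/subvf.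
have [_ /asboolP[X [<- freeX XS]] Xmax] := ex_maxnP exQ Qmax.
exists (size X), (in_tuple X); last first.
  by move=> i; apply: XS; apply: mem_tnth.
have SX x : S x -> x \in <<X>>%VS.
  move=> Sx; apply/negP => /negP xX.
  have /Xmax /= : Q (size (x :: X)); last by rewrite ltnn.
  apply/asboolP; exists (x :: X); split=> //; first by rewrite free_cons xX.
  by move=> y; rewrite inE => /predU1P[->|/XS].
suff spanX : <<X>>%VS = fullv by rewrite /basis_of /= spanX eqxx.
apply/eqP; rewrite eqEsubv subvf; apply/subvP => x _.
have /asboolP[s [sS ->]] := spanS x; rewrite big_seq.
by apply: memv_suml => p /sS Sp; apply/memvZ/SX.
Qed.

Lemma lspan_ind (S : set V) (P : V -> Prop) :
  P 0 -> (forall a x y, P x -> P y -> P (a *: x + y)) ->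
  (forall x, S x -> P x) -> forall x, x \in lspan S -> P x.
Proof.
move=> P0 PD PS x /asboolP[s [sS ->]]; rewrite big_seq.
by elim/big_rec: _ => // p y /sS /PS Pp; apply: PD.
Qed.

Lemma coord_sum n (b : n.-tuple V) x :
  basis_of fullv b -> x = \sum_i coord b i x *: tnth b i.
Proof.
move=> bb; rewrite {1}(coord_basis bb (memvf x)).
by apply: eq_bigr => i _; rewrite -tnth_nth.
Qed.

(** The matrix of the f i in a basis has independent rows, hence a right
   inverse. *)
Lemma free_functionals n (f : 'I_n -> 'Hom(V, F^o)) (c : 'I_n -> F) :
  free [seq f i | i : 'I_n] -> exists x, forall i, f i x = c i.
Proof.
move=> freef; pose e := vbasis (fullv : {vspace V}).
pose A := \matrix_(i < n, j < \dim (fullv : {vspace V})) (f i (tnth e j) : F).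
have fE (g : 'Hom(V, F^o)) x :
    g x = \sum_j coord e j x * (g (tnth e j) : F) :> F.
  rewrite {1}(coord_sum x (vbasisP _)) linear_sum.
  by apply: eq_bigr => j _; rewrite linearZ.
have freeA : row_free A.
  rewrite -kermx_eq0; apply/rowV0P => v /sub_kermxP vA.
  have /freeP fr : free [tuple f i | i < n] by [].
  apply/rowP => i; rewrite mxE; apply: fr => {i}.
  apply/lfunP => x; rewrite sum_lfunE zero_lfunE.
  have /rowP vA0 := vA.
  transitivity (\sum_j coord e j x * (v *m A) 0 j); last first.
    by apply: big1 => j _; rewrite vA0 mxE mulr0.
  under [RHS]eq_bigr => j _ do rewrite mxE mulr_sumr.
  rewrite exchange_big /=; apply: eq_bigr => i _.
  rewrite (_ : _`_i = f i) ?scale_lfunE ?fE ?scaler_sumr; last first.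
    by rewrite -[RHS](tnth_mktuple f i) (tnth_nth 0).
  by apply: eq_bigr => j _; rewrite mxE mulrCA.
have [x /colP Ax] : exists x, A *m x = \col_i c i.
  by exists (pinvmx A *m \col_i c i); rewrite mulmxA mulmxVp ?mul1mx.
exists (\sum_j x j 0 *: tnth e j) => i.
have := Ax i; rewrite !mxE => <-; rewrite linear_sum; apply: eq_bigr => j _.
by rewrite linearZ_LR mxE mulrC.
Qed.

(** Only the basis vectors of the same eigenvalue occur in an eigenvector. *)
Lemma coord_eigen n (b : n.-tuple V) (f : V -> V) (c : 'I_n -> F) a x i :
  basis_of fullv b -> linear f -> (forall j, f (tnth b j) = c j *: tnth b j) ->
  f x = a *: x -> coord b i x != 0 -> c i = a.
Proof.
move=> bb lf fb fx xi.
pose fl := GRing.isLinear.Build F V V *:%R f lf.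
pose g : {linear V -> V} := HB.pack f fl.
have := congr1 (coord b i) fx.
rewrite {1}(coord_basis bb (memvf x)) [f _](linear_sum g) /= linear_sum.
rewrite (bigD1 i) //= big1 => [|j ij].
  rewrite [f _](linearZ_LR g) /= -tnth_nth fb !linearZ /= (tnth_nth 0).
  rewrite coord_free ?(basis_free bb) // eqxx mulr1 addr0 mulrC.
  exact/mulIf.
rewrite [f _](linearZ_LR g) /= -tnth_nth fb !linearZ /= (tnth_nth 0).
by rewrite coord_free ?(basis_free bb) // (negPf ij) !mulr0.
Qed.

Lemma coord_tnth n (b : n.-tuple V) i j :
  basis_of fullv b -> coord b i (tnth b j) = (j == i)%:R.
Proof.
by move=> bb; rewrite (tnth_nth 0) coord_free ?(basis_free bb) // eq_sym.
Qed.

End LinearAlgebra.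

Section Lift.
Variables (F : pzRingType) (Lam : choiceType) (V W : lmodType F).
Implicit Type g : Lam -> {linear V -> W}.

(** For linear g r, this is the linear map with x t^r |-> g r x. *)
Definition fsupp_lift (g : Lam -> V -> W) (f : fsupp Lam V) : W :=
  \sum_(r \in [set: Lam]) g r (f r).

Lemma fsupp_liftE g (f : fsupp Lam V) (A : {fset Lam}) :
  (forall r, r \notin A -> f r = 0) ->
  fsupp_lift g f = \sum_(r <- A) g r (f r).
Proof. by move=> fA; apply: fsbigTE => r /fA ->; rewrite linear0. Qed.

Lemma fsupp_lift_is_linear g : linear (fsupp_lift g).
Proof.
move=> a u v; have [P uP] := fsupp_bound u; have [Q vQ] := fsupp_bound v.
have uPQ r : r \notin (P `|` Q)%fset -> u r = 0.
  by rewrite inE negb_or => /andP[/uP].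
have vPQ r : r \notin (P `|` Q)%fset -> v r = 0.
  by rewrite inE negb_or => /andP[_ /vQ].
rewrite !(@fsupp_liftE _ _ (P `|` Q)%fset) //; last first.
  move=> r r_PQ; have : a *: u r + v r = 0; last by [].
  by rewrite uPQ // vPQ // scaler0 addr0.
rewrite scaler_sumr -big_split /=; apply: eq_bigr => r _.
exact: (linearP (g r)).
Qed.

Lemma fsupp_lift_single g r x : fsupp_lift g (single r x) = g r x.
Proof.
rewrite (@fsupp_liftE _ _ [fset r]%fset) => [|s].
  by rewrite big_seq_fset1 /= eqxx.
by rewrite inE /= => /negPf ->.
Qed.

End Lift.

Section LieGeneral.
Variables (F : comPzRingType) (L : lieAlgType F).
Implicit Types x y z : L.

HB.instance Definition _ x :=
  GRing.isLinear.Build F L L _ (lie x) (lie_linearr x).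

Lemma lieNr x y : lie x (- y) = - lie x y. Proof. exact: linearN. Qed.
Lemma lieNl x y : lie (- x) y = - lie x y.
Proof. by rewrite lieC lieNr -lieC. Qed.
Lemma lie_sumr I (r : seq I) (P : pred I) (f : I -> L) x :
  lie x (\sum_(i <- r | P i) f i) = \sum_(i <- r | P i) lie x (f i).
Proof. exact: linear_sum. Qed.
Lemma lie_suml I (r : seq I) (P : pred I) (f : I -> L) x :
  lie (\sum_(i <- r | P i) f i) x = \sum_(i <- r | P i) lie (f i) x.
Proof.
by rewrite lieC lie_sumr -sumrN; apply: eq_bigr => i _; rewrite -lieC.
Qed.

Lemma lie_derivation x y z :
  lie x (lie y z) = lie (lie x y) z + lie y (lie x z).
Proof.
have /eqP := lie_jacobi x y z; rewrite -addrA addr_eq0 => /eqP ->.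
by rewrite opprD addrC -lieC [lie z x]lieC lieNr opprK.
Qed.

Lemma lie_eigen z x y a c : lie z x = a *: x -> lie z y = c *: y ->
  lie z (lie x y) = (a + c) *: lie x y.
Proof. by move=> zx zy; rewrite lie_derivation zx zy lieZl lieZr scalerDl. Qed.

End LieGeneral.

(** * Linear maps on the toroidal algebra *)

Lemma loop_elt_is_linear (F : comNzRingType) (G : lieAlgType F)
  (B : invForm G) (Lam : zmodType) (Z : lmodType F) (kappa : cocycle Lam Z) r :
  linear (loop_elt B kappa r).
Proof.
move=> a x y; rewrite /loop_elt linearP.
by congr pair; rewrite /= scaler0 addr0.
Qed.

Section LoopMaps.
Variables (F : numFieldType) (G : finLieAlgType F) (B : invForm G) (M N : nat).
Local Notation tor := (toroidal M N B).
Local Notation Om := (OmegadA F M N).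
Local Notation cen := (central_elt B (toroidal_cocycle F M N)).
Local Notation cls := (quot_class (dA_gen F M N)).

Lemma central_is_linear : linear (cen : Om -> tor).
Proof. by move=> a x y; congr pair; rewrite /= scaler0 addr0. Qed.
HB.instance Definition _ :=
  GRing.isLinear.Build F Om tor _ (central_elt B (toroidal_cocycle F M N))
    central_is_linear.
HB.instance Definition _ r :=
  GRing.isLinear.Build F G tor _ (loop_elt B (toroidal_cocycle F M N) r)
    (loop_elt_is_linear B (toroidal_cocycle F M N) r).

Lemma lie_centralr u z : lie u (cen z) = 0 :> tor.
Proof. by rewrite lieC lie_central oppr0. Qed.

Lemma lie_tor_eltE x y r0 r s0 s :
  lie (tor_elt M B x r0 r) (tor_elt M B y s0 s) =
  tor_elt M B (lie x y) (r0 + s0) (r + s) + B x y *: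
    cen (cls (single (r0 + s0, r + s) (dlog F M (r0, r)))).
Proof. by rewrite /tor_elt lie_loop_elt linearZ. Qed.

Lemma tor_ind (P : tor -> Prop) :
  (forall u v, P u -> P v -> P (u + v)) ->
  (forall x r0 r, P (tor_elt M B x r0 r)) ->
  (forall r v, P (cen (cls (single r v)))) -> forall u, P u.
Proof.
move=> PD Pe Pc; elim/loop_ext_ind => // [[r0 r] x|z]; first exact: Pe.
have [v ->] := quot_classP z.
elim/fsupp_ind: v => [|f g Pf Pg|r v //].
  by have := Pc (0, 0) 0; rewrite !linear0.
by rewrite linearD /= linearD; apply: PD.
Qed.

Variables (W : lmodType F).

(** The linear map with value [g r x] at x t^r and [c (single r v)] at the class
   of t^r v. The second family must vanish on d_A; a representative of the class
   is chosen because [g] and [c] then are the only data. *)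
Definition tor_map (g : texp N -> {linear G -> W})
    (c : Omega F N -> W) (u : tor) : W :=
  fsupp_lift g u.1 + c (repr (u.2 : Quotient.quot (lspan (dA_gen F M N)))).

Variables (g : texp N -> {linear G -> W}) (c : {linear Omega F N -> W}).
Hypothesis cdA : forall r, c (single r (dlog F M r)) = 0.

Lemma repr_cls v :
  c (repr (cls v : Quotient.quot (lspan (dA_gen F M N)))) = c v.
Proof.
apply/eqP; rewrite -subr_eq0 -linearB; set w := _ - v.
have /asboolP[s [sP ->]] : w \in lspan (dA_gen F M N).
  by apply/quot_classE; rewrite /quot_class reprK.
rewrite linear_sum big_seq big1 // => p /sP[r _ <-].
by rewrite linearZ_LR /= cdA scaler0.
Qed.

Lemma tor_map_is_linear : linear (tor_map g c).
Proof.
move=> a [f z] [f' z']; rewrite /tor_map /= fsupp_lift_is_linear.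
have [v ->] := quot_classP z; have [v' ->] := quot_classP z'.
by rewrite -linearP !repr_cls linearP scalerDr addrACA.
Qed.

Lemma tor_map_elt x r0 r : tor_map g c (tor_elt M B x r0 r) = g (r0, r) x.
Proof.
rewrite /tor_map /tor_elt /loop_elt /= fsupp_lift_single.
by rewrite -[X in repr X](linear0 cls) repr_cls linear0 addr0.
Qed.

Lemma tor_map_cls v : tor_map g c (cen (cls v)) = c v.
Proof.
rewrite /tor_map /central_elt /= repr_cls.
rewrite [X in X + _](_ : _ = 0) ?add0r //.
by rewrite /fsupp_lift fsbig1 // => r _; exact: linear0.
Qed.

End LoopMaps.

(** * The twist by an element with integral eigenvalues *)

Section Twist.
Variables (F : numFieldType) (G : finLieAlgType F) (B : invForm G).
Variables (K q N : nat).
Hypotheses (K_gt0 : (0 < K)%N) (q_gt0 : (0 < q)%N).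
Local Notation m := (K * q)%N.
Variables (X : G) (n : nat) (b : n.-tuple G) (k : 'I_n -> int).
Hypotheses (bb : basis_of fullv b).
Hypothesis Xb : forall i, lie X (tnth b i) = (k i)%:~R *: tnth b i.

Local Notation cls M := (quot_class (dA_gen F M N)).
Local Notation cen M := (central_elt B (toroidal_cocycle F M N)).

(** The exponent r0 of t counts as r0 / K on one side and the exponent
   q r0 + x as r0 / K + x / m on the other: an additional shift x in the
   exponent costs (x / m) k_0. *)
Lemma dlog_scale (r : texp N) (x : int) : dlog F m (r.1 * q%:Z + x, r.2) =
  dlog F K r + (x%:~R / m%:R) *: k_ F ord0 :> 'rV[F]_N.+1.
Proof.
have K0 : K%:R != 0 :> F by rewrite pnatr_eq0 -lt0n.
have q0 : q%:R != 0 :> F by rewrite pnatr_eq0 -lt0n.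
rewrite /dlog /= addrAC -scalerDl rmorphD rmorphM /= natrM -pmulrn.
congr (_ *: _ + _); field; exact/andP.
Qed.

Lemma dlog_mul r0 r :
  dlog F m (r0 * q%:Z, r) = dlog F K (r0, r) :> 'rV[F]_N.+1.
Proof.
by rewrite -[r0 * _]addr0 (dlog_scale (r0, r)) mul0r scale0r addr0.
Qed.

(** On x t^r0 t^r with [X, x] = j x, the twist is x t^(q r0 + j) t^r plus a
   multiple of k_0; the basis makes this linear in x. *)
Definition twist_term (r : texp N) (x : G) : toroidal m N B :=
  \sum_i coord b i x *: tor_elt m B (tnth b i) (r.1 * q%:Z + k i) r.2
  + (B x X / m%:R) *: tor_k m B (r.1 * q%:Z) r.2 ord0.

(** Each [tnth b i] t^s0 with q | s0 - k i has a preimage under the twist, once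
   the multiple of k_0 is subtracted; sending the remaining exponents to 0 gives
   a left inverse. *)
Definition untwist_term (s : texp N) (x : G) : toroidal K N B :=
  \sum_(i | (q %| s.1 - k i)%Z) coord b i x *:
    (tor_elt K B (tnth b i) ((s.1 - k i) %/ q)%Z s.2
     - (B (tnth b i) X / m%:R) *: tor_k K B ((s.1 - k i) %/ q)%Z s.2 ord0).

Lemma twist_term_is_linear r : linear (twist_term r).
Proof.
move=> a x y; rewrite /twist_term scalerDr [RHS]addrACA; congr (_ + _).
  rewrite scaler_sumr -big_split /=; apply: eq_bigr => i _.
  by rewrite linearP scalerDl scalerA.
by rewrite linearPl /= mulrDl scalerDl -mulrA scalerA.
Qed.
HB.instance Definition _ r :=
  GRing.isLinear.Build F G _ _ (twist_term r) (twist_term_is_linear r).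

Lemma untwist_term_is_linear s : linear (untwist_term s).
Proof.
move=> a x y; rewrite /untwist_term scaler_sumr -big_split /=.
by apply: eq_bigr => i _; rewrite linearP scalerDl scalerA.
Qed.
HB.instance Definition _ s :=
  GRing.isLinear.Build F G _ _ (untwist_term s) (untwist_term_is_linear s).

Definition twist_center : Omega F N -> toroidal m N B :=
  fsupp_lift (fun r => cen m \o (cls m \o single (r.1 * q%:Z, r.2)) :
    {linear 'rV[F]_N.+1 -> toroidal m N B}).

Definition untwist_center : Omega F N -> toroidal K N B :=
  fsupp_lift (fun s => if (q %| s.1)%Z
    then (cen K \o (cls K \o single ((s.1 %/ q)%Z, s.2)) :
           {linear 'rV[F]_N.+1 -> toroidal K N B})
    else \0 ).
HB.instance Definition _ := GRing.isLinear.Build F (Omega F N) _ _ twist_center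
  (fsupp_lift_is_linear _).
HB.instance Definition _ := GRing.isLinear.Build F (Omega F N) _ _
  untwist_center (fsupp_lift_is_linear _).

Lemma twist_center_dA r : twist_center (single r (dlog F K r)) = 0.
Proof.
case: r => r0 r; rewrite /twist_center fsupp_lift_single /=.
by rewrite -dlog_mul dA_eq0 linear0.
Qed.

Lemma untwist_center_dA s : untwist_center (single s (dlog F m s)) = 0.
Proof.
case: s => s0 s; rewrite /untwist_center fsupp_lift_single.
case: ifP => //= /dvdzP[u ->]; rewrite mulzK ?eqz_nat -?lt0n //.
by rewrite dlog_mul dA_eq0 linear0.
Qed.

Definition twist : toroidal K N B -> toroidal m N B :=
  tor_map twist_term twist_center.
Definition untwist : toroidal m N B -> toroidal K N B :=
  tor_map untwist_term untwist_center.
#[local] HB.instance Definition _ := GRing.isLinear.Build F _ _ _ twist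
  (tor_map_is_linear twist_term twist_center_dA).
#[local] HB.instance Definition _ := GRing.isLinear.Build F _ _ _ untwist
  (tor_map_is_linear untwist_term untwist_center_dA).

Lemma twist_is_linear : linear twist.
Proof. exact: linearP. Qed.

Lemma twistD u v : twist (u + v) = twist u + twist v.
Proof. exact: linearD. Qed.

Lemma twist_cls r v :
  twist (cen K (cls K (single r v))) =
  cen m (cls m (single (r.1 * q%:Z, r.2) v)).
Proof.
rewrite /twist tor_map_cls; last exact: twist_center_dA.
by rewrite /= /twist_center fsupp_lift_single.
Qed.

Lemma twist_k r0 r i :
  twist (tor_k K B r0 r i) = tor_k m B (r0 * q%:Z) r i.
Proof. exact: twist_cls. Qed.

Lemma twist_elt (j : int) x r0 r : lie X x = j%:~R *: x ->
  twist (tor_elt K B x r0 r) = tor_elt m B x (r0 * q%:Z + j) r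
    + (B x X / m%:R) *: tor_k m B (r0 * q%:Z) r ord0.
Proof.
move=> Xx; rewrite /twist tor_map_elt; last exact: twist_center_dA.
rewrite /= /twist_term /=; congr (_ + _).
rewrite {2}(coord_sum x bb) /tor_elt linear_sum; apply: eq_bigr => i _.
rewrite linearZ_LR /=; have [->|xi] := eqVneq (coord b i x) 0.
  by rewrite !scale0r.
have /intr_inj -> // := coord_eigen bb (lie_linearr X) Xb Xx xi.
Qed.

Lemma untwist_cls r v :
  untwist (cen m (cls m (single (r.1 * q%:Z, r.2) v))) =
  cen K (cls K (single r v)).
Proof.
rewrite /untwist tor_map_cls; last exact: untwist_center_dA.
rewrite /= /untwist_center fsupp_lift_single /= dvdz_mull // mulzK.
  by case: r.
by rewrite eqz_nat -lt0n.
Qed.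

Lemma untwist_elt i r0 r :
  untwist (tor_elt m B (tnth b i) (r0 * q%:Z + k i) r) =
  tor_elt K B (tnth b i) r0 r
  - (B (tnth b i) X / m%:R) *: tor_k K B r0 r ord0.
Proof.
rewrite /untwist tor_map_elt; last exact: untwist_center_dA.
rewrite /= /untwist_term /= (bigD1 i) /=; last by rewrite addrK dvdz_mull.
rewrite big1 => [|j /andP[_ ji]]; last first.
  by rewrite coord_tnth // eq_sym (negPf ji) scale0r.
by rewrite addr0 coord_tnth // eqxx scale1r addrK mulzK // eqz_nat -lt0n.
Qed.

(** This is how injectivity of the twist is proved. *)
Lemma twistK : cancel twist untwist.
Proof.
elim/tor_ind => [u v IHu IHv|x r0 r|r v].
- by rewrite twistD (linearD untwist) /= IHu IHv.
- rewrite (coord_sum x bb) /tor_elt !linear_sum; apply: eq_bigr => i _.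
  rewrite !linearZ_LR /=; congr (_ *: _).
  rewrite -/(tor_elt K B _ _ _) (twist_elt _ _ (Xb i)) linearD linearZ_LR /=.
  by rewrite untwist_elt (untwist_cls (r0, r)) subrK.
- by rewrite twist_cls untwist_cls.
Qed.

Lemma inv_form_eigen x y (i j : int) : lie X x = i%:~R *: x ->
  lie X y = j%:~R *: y -> i + j != 0 -> B x y = 0.
Proof.
move=> Xx Xy ij; apply/eqP; have : (i + j)%:~R * B x y == 0.
  rewrite rmorphD mulrDl -linearZl_LR -linearZr_LR /= -Xx -Xy.
  by rewrite [lie X x]lieC linearNl /= inv_form_lie addNr.
by rewrite mulf_eq0 intr_eq0 (negPf ij).
Qed.

Lemma inv_form_bracket x y (j : int) : lie X y = j%:~R *: y ->
  B (lie x y) X = - (j%:~R * B x y).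
Proof.
by move=> Xy; rewrite inv_form_lie lieC Xy linearNr /= linearZr_LR.
Qed.

(** If i + j <> 0, then both B(x, y) and B([x, y], X) vanish. Otherwise
   the cocycle on the right exceeds the one on the left by (i / m) B(x, y) k_0,
   and B([x, y], X) = - j B(x, y) = i B(x, y) supplies this term. *)
Lemma twist_lie_eigen (i j : int) x y r0 r s0 s :
  lie X x = i%:~R *: x -> lie X y = j%:~R *: y ->
  twist (lie (tor_elt K B x r0 r) (tor_elt K B y s0 s)) =
  lie (twist (tor_elt K B x r0 r)) (twist (tor_elt K B y s0 s)).
Proof.
move=> Xx Xy; rewrite (twist_elt _ _ Xx) (twist_elt _ _ Xy).
have Xxy : lie X (lie x y) = (i + j)%:~R *: lie x y.
  by rewrite rmorphD; apply: lie_eigen.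
rewrite lieDl !lieDr !lieZl !lieZr !lie_centralr !scaler0.
rewrite lie_central !scaler0 !addr0 !lie_tor_eltE linearD linearZ_LR /=.
rewrite twist_cls (twist_elt _ _ Xxy) /= (inv_form_bracket _ Xy).
have [ij|ij] := eqVneq (i + j) 0; last first.
  rewrite (inv_form_eigen Xx Xy ij) mulr0 oppr0 mul0r !scale0r !addr0.
  by congr (tor_elt _ _ _ _ _); rewrite mulrDl addrACA.
have -> : r0 * q%:Z + i + (s0 * q%:Z + j) = (r0 + s0) * q%:Z.
  by rewrite mulrDl addrACA ij addr0.
rewrite ij addr0 -addrA; congr (_ + _); rewrite (dlog_scale (r0, r)) /tor_k.
set e : texp N := (_ * _, _).
pose g : {linear 'rV[F]_N.+1 -> toroidal m N B} := cen m \o (cls m \o single e).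
have gE v : cen m (cls m (single e v)) = g v by [].
rewrite !gE; move: (dlog F K _) => d.
rewrite (linearD g) (linearZ_LR g) /= scalerDr addrC; congr (_ + _).
have -> : j = - i by apply/eqP; rewrite -addr_eq0 addrC ij.
by rewrite scalerA mulrNz !mulNr opprK mulrA [B x y * _]mulrC.
Qed.

Lemma twist_lie u v : twist (lie u v) = lie (twist u) (twist v).
Proof.
elim/tor_ind: u => [u u' IHu IHu'|x r0 r|r z]; last first.
- by rewrite lie_central linear0 twist_cls lie_central.
- elim/tor_ind: v => [v v' IHv IHv'|y s0 s|s z]; last first.
  + by rewrite lie_centralr linear0 twist_cls lie_centralr.
  + have eltE z (z0 : texp N) : loop_elt B (toroidal_cocycle F K N) z0 z =
        \sum_i coord b i z *: tor_elt K B (tnth b i) z0.1 z0.2.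
      rewrite {1}(coord_sum z bb) linear_sum; apply: eq_bigr => i _.
      by rewrite linearZ_LR; case: z0.
    rewrite /tor_elt !eltE. rewrite lie_suml !(linear_sum twist) lie_suml.
    apply: eq_bigr => i _; rewrite !lie_sumr (linear_sum twist).
    apply: eq_bigr => j _; rewrite !(linearZ_LR twist) !lieZl !lieZr.
    by rewrite !(linearZ_LR twist) /= -(twist_lie_eigen _ _ _ _ (Xb i) (Xb j)).
  + rewrite lieDr (twistD v) (twistD (lie _ v)) (lieDr (twist _)).
    by rewrite [X in X + _]IHv [X in _ + X]IHv'.
- rewrite lieDl (twistD u) (twistD (lie u v)) (lieDl (twist u)).
  by rewrite [X in X + _]IHu [X in _ + X]IHu'.
Qed.

End Twist.

(** * Gradings by an automorphism, and the algebras L-bar *)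

Section Graded.
Variables (F : numFieldType) (G : finLieAlgType F) (B : invForm G).
Variables (M : nat) (sigma : 'End(G)) (rho : F).
Hypothesis prim_rho : M.-primitive_root rho.

Lemma prim_unit : rho \is a GRing.unit.
Proof.
by rewrite -(unitrX_pos _ (prim_order_gt0 prim_rho)) prim_expr_order ?unitr1.
Qed.

Lemma prim_exprz_eq1 (i : int) : (rho ^ i == 1) = (M%:Z %| i)%Z.
Proof.
case: i => j; first by rewrite -exprnP -(prim_order_dvd prim_rho).
by rewrite NegzE rpredN -exprnN invr_eq1 -(prim_order_dvd prim_rho).
Qed.

Lemma prim_exprz_eq (i j : int) : (rho ^ i == rho ^ j) = (M%:Z %| i - j)%Z.
Proof.
have rho0 : rho != 0 by rewrite -unitfE prim_unit.
rewrite -prim_exprz_eq1 expfzDr // -invr_expz.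
have rj0 := expfz_neq0 j rho0.
apply/eqP/eqP => [->|/(canRL (mulfVK rj0))]; first by rewrite mulfV.
by rewrite mul1r.
Qed.

Lemma mem_graded x i : (x \in graded sigma rho i) = (sigma x == rho ^ i *: x).
Proof.
rewrite /graded /passmx.leigenspace memv_ker add_lfunE opp_lfunE scale_lfunE.
by rewrite id_lfunE subr_eq0.
Qed.

Lemma graded_mod (i j : int) : (M%:Z %| i - j)%Z ->
  graded sigma rho i = graded sigma rho j.
Proof. by rewrite -prim_exprz_eq /graded => /eqP ->. Qed.

Lemma mem_graded_mod x (i j : int) : (M%:Z %| i - j)%Z ->
  x \in graded sigma rho j -> x \in graded sigma rho i.
Proof. by move=> /graded_mod ->. Qed.

Lemma graded_lie x y i j : {morph sigma : u v / lie u v} ->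
  x \in graded sigma rho i -> y \in graded sigma rho j ->
  lie x y \in graded sigma rho (i + j).
Proof.
move=> sigmaL; rewrite !mem_graded sigmaL => /eqP -> /eqP ->.
by rewrite lieZl lieZr scalerA expfzDr // -unitfE prim_unit.
Qed.

Hypothesis sigma_lie : {morph sigma : u v / lie u v}.
Hypothesis sigma_B : forall x y, B (sigma x) (sigma y) = B x y.

(** For this reason the brackets of elements of L-bar only involve the central
   elements t^r0 t^r k_i with M | r0. *)
Lemma inv_form_graded x y i j :
  x \in graded sigma rho i -> y \in graded sigma rho j -> B x y != 0 ->
  (M%:Z %| i + j)%Z.
Proof.
rewrite !mem_graded => /eqP sx /eqP sy xy0; rewrite -prim_exprz_eq1.
have := sigma_B x y; rewrite sx sy linearZl_LR linearZr_LR /= mulrA.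
rewrite -expfzDr; last by rewrite -unitfE prim_unit.
by move=> /(canRL (mulfK xy0)); rewrite mulfV // => ->.
Qed.

Variable N : nat.
Local Notation L := (Lbar B M N sigma rho).
Local Notation cls := (quot_class (dA_gen F M N)).
Local Notation cen := (central_elt B (toroidal_cocycle F M N)).

Lemma Lbar_linear a u v : L u -> L v -> L (a *: u + v).
Proof.
move=> [gu cu] [gv cv]; split=> [r|]; last by rewrite rpredD ?rpredZ.
by apply: (memvD (memvZ a (gu r)) (gv r)).
Qed.

Lemma Lbar_elt x r0 r : x \in graded sigma rho r0 -> L (tor_elt M B x r0 r).
Proof.
move=> xr; split=> [s|]; last exact: rpred0.
by rewrite /=; case: eqP => [->|_]; rewrite ?mem0v.
Qed.

Lemma Lbar_k r0 r i : (M%:Z %| r0)%Z -> L (tor_k M B r0 r i).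
Proof.
move=> Mr; split=> [s|]; first by rewrite mem0v.
by apply: lspan_gen; exists (r0, r), i.
Qed.

(** L-bar is spanned by its elements x t^r0 t^r and t^r0 t^r k_i. *)
Lemma Lbar_ind (P : toroidal M N B -> Prop) :
  (forall a u v, P u -> P v -> P (a *: u + v)) ->
  (forall x r0 r, x \in graded sigma rho r0 -> P (tor_elt M B x r0 r)) ->
  (forall r0 r i, (M%:Z %| r0)%Z -> P (tor_k M B r0 r i)) ->
  forall u, L u -> P u.
Proof.
move=> PD Pe Pk [f z] [/= fP zP].
have P0 : P 0.
  by have := Pe 0 0 0 (mem0v _); rewrite /tor_elt linear0.
have Psum I (s : seq I) (c : I -> F) (u : I -> toroidal M N B) :
    (forall i, P (u i)) -> P (\sum_(i <- s) c i *: u i).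
  by move=> Pu; elim/big_rec: _ => // i x _; apply: PD.
have -> : (f, z) = 1 *: ((f, 0) : toroidal M N B) + cen z.
  by rewrite scale1r; congr pair; rewrite /= ?addr0 ?add0r.
apply: (PD).
  have [A fA] := fsupp_bound f.
  have -> : ((f, 0) : toroidal M N B) =
      \sum_(r <- A) 1 *: tor_elt M B (f r) r.1 r.2.
    apply: (etrans (y := (\sum_(r <- A) single r (f r), 0))).
      by rewrite -(fsuppE fA).
    elim/big_rec2: _ => // r u v _ <-; rewrite scale1r; case: r => r0 r.
    by congr pair; rewrite /= addr0.
  by apply: Psum => -[r0 r]; apply/Pe/fP.
have /asboolP[s [sP ->]] := zP; rewrite linear_sum big_seq.
elim/big_rec: _ => // p x /sP[[r0 r] [i [Mr ->]]] Px.
by rewrite linearZ_LR; apply: PD => //; apply: Pk.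
Qed.

Lemma Lbar_subalgebra : lie_subalgebra L.
Proof.
have L0 : L 0.
  by have := Lbar_elt 0 (mem0v (graded sigma rho 0)); rewrite /tor_elt linear0.
split=> //; first exact: Lbar_linear.
have LD u v : L u -> L v -> L (u + v).
  by move=> Lu Lv; rewrite -[u]scale1r; apply: Lbar_linear.
have LZ a u : L u -> L (a *: u).
  by move=> Lu; rewrite -[_ *: _]addr0; apply: Lbar_linear.
move=> u v Lu Lv; move: u Lu.
apply: Lbar_ind => [a u u' Lu Lu'|x r0 r xr|r0 r i _].
- by rewrite lieDl lieZl; apply: Lbar_linear.
- move: v Lv; apply: Lbar_ind => [a v v' Lv Lv'|y s0 s ys|s0 s i _].
  + by rewrite lieDr lieZr; apply: Lbar_linear.
  + rewrite lie_tor_elt; have [xy0|xy0] := eqVneq (B x y) 0.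
      rewrite xy0 mul0r mul0r !scale0r !addr0; apply/Lbar_elt/graded_lie => //.
    have rs := inv_form_graded xr ys xy0.
    apply: (LD _ _ (LD _ _ _ _) _); first exact/Lbar_elt/graded_lie.
      by apply/LZ/Lbar_k.
    apply: LZ; elim/big_rec: _ => // i w _ Lw.
    by apply: Lbar_linear => //; apply: Lbar_k.
  + by rewrite lie_centralr.
- by rewrite lie_central.
Qed.

End Graded.

(** * The twist as an isomorphism of the algebras L-bar *)

Section TwistLbar.
Variables (F : numFieldType) (G : finLieAlgType F) (B : invForm G).
Variables (K q N : nat).
Hypotheses (K_gt0 : (0 < K)%N) (q_gt0 : (0 < q)%N).
Local Notation m := (K * q)%N.
Variables (X : G) (n : nat) (b : n.-tuple G) (k d : 'I_n -> int).
Hypotheses (bb : basis_of fullv b).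
Hypothesis Xb : forall i, lie X (tnth b i) = (k i)%:~R *: tnth b i.
Variables (pi theta : 'End(G)) (eps omega : F).
Hypotheses (prim_eps : K.-primitive_root eps)
           (prim_omega : m.-primitive_root omega).
Hypotheses (pi_lie : {morph pi : u v / lie u v})
           (theta_lie : {morph theta : u v / lie u v}).
Hypotheses (pi_B : forall x y, B (pi x) (pi y) = B x y)
           (theta_B : forall x y, B (theta x) (theta y) = B x y).
Hypothesis X0 : X \in graded pi eps 0.
Hypothesis b_pi : forall i, tnth b i \in graded pi eps (d i).
Hypothesis b_theta : forall i,
  tnth b i \in graded theta omega (k i + q%:Z * d i).

Local Notation L := (Lbar B K N pi eps).
Local Notation L' := (Lbar B m N theta omega).
Local Notation phi := (twist q X b k : toroidal K N B -> toroidal m N B).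
#[local] HB.instance Definition _ := GRing.isLinear.Build F _ _ _ phi
  (twist_is_linear K_gt0 q_gt0 X b k).

Let phiP a u v : phi (a *: u + v) = a *: phi u + phi v.
Proof. exact: (linearP phi). Qed.
Let phiZ a u : phi (a *: u) = a *: phi u.
Proof. exact: (linearZ_LR phi). Qed.

Lemma coord_graded M sigma rho (e : 'I_n -> int) i x j :
  M.-primitive_root rho -> (forall i, tnth b i \in graded sigma rho (e i)) ->
  x \in graded sigma rho j -> coord b i x != 0 -> (M%:Z %| j - e i)%Z.
Proof.
move=> prim_rho be; rewrite mem_graded => /eqP sx xi.
rewrite -(prim_exprz_eq prim_rho) eq_sym; apply/eqP.
apply: (coord_eigen (c := fun i => rho ^ e i) bb _ _ sx xi).
  by move=> a u v; rewrite linearP.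
by move=> i'; move: (be i'); rewrite mem_graded => /eqP.
Qed.

Lemma tor_elt_coord M x r0 r : tor_elt M B x r0 r =
  \sum_(i | coord b i x != 0) coord b i x *: tor_elt M B (tnth b i) r0 r
    :> toroidal M N B.
Proof.
rewrite {1}(coord_sum x bb) /tor_elt linear_sum [RHS]big_mkcond /=.
apply: eq_bigr => i _; rewrite linearZ_LR /=.
by have [->|] := eqVneq (coord b i x) 0; rewrite ?scale0r.
Qed.

(** The correction by k_0 in the twist occurs only when t^(q r0) t^r k_0 belongs
   to L-bar, as X has degree 0. *)
Lemma form_X i r0 : tnth b i \in graded pi eps r0 -> B (tnth b i) X != 0 ->
  (K%:Z %| r0)%Z.
Proof.
by move=> bi /(inv_form_graded prim_eps pi_B bi X0); rewrite addr0.
Qed.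

Lemma twist_Lbar u : L u -> L' (phi u).
Proof.
have L'0 : L' 0 by case: (Lbar_subalgebra prim_omega theta_lie theta_B N).
move: u; apply: (Lbar_ind (P := fun u => L' (phi u))) => [a u v Lu Lv||].
- by rewrite phiP; apply: Lbar_linear.
- move=> x r0 r xr; rewrite tor_elt_coord (linear_sum phi) /=.
  elim/big_rec: _ => // i u xi Lu.
  rewrite phiZ; apply: Lbar_linear => //.
  have r0i := coord_graded prim_eps b_pi xr xi.
  rewrite (twist_elt _ _ _ bb Xb _ _ (Xb i)) // -[tor_elt _ _ _ _ _]scale1r.
  apply: Lbar_linear.
    apply/Lbar_elt/(mem_graded_mod prim_omega _ (b_theta i)).
    have -> : r0 * q%:Z + k i - (k i + q%:Z * d i) = (r0 - d i) * q%:Z by ring.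
    by rewrite PoszM dvdz_mul.
  have [->|biX] := eqVneq (B (tnth b i) X) 0; first by rewrite mul0r scale0r.
  rewrite -[_ *: _]addr0; apply: Lbar_linear => //; apply: Lbar_k.
  rewrite PoszM dvdz_mul //; apply: form_X biX.
  exact: (mem_graded_mod prim_eps r0i (b_pi i)).
- move=> r0 r i Kr0; rewrite twist_k //; apply: Lbar_k.
  by rewrite PoszM dvdz_mul.
Qed.

(** If theta acts on [tnth b i] by omega^s0, then s0 = k i + q r0 for some r0
   congruent to d i modulo K, so that x t^s0 is a value of the twist up to the
   central term. *)
Lemma twist_Lbar_surj u : L' u -> exists2 v, L v & phi v = u.
Proof.
have L0 : L 0 by case: (Lbar_subalgebra prim_eps pi_lie pi_B N).
have q0 : q%:Z != 0 by rewrite eqz_nat -lt0n.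
move: u; apply: (Lbar_ind (P := fun u => exists2 v, L v & phi v = u)).
- move=> a _ _ [u Lu <-] [v Lv <-]; exists (a *: u + v); last exact: phiP.
  exact: Lbar_linear.
- move=> x s0 s xs; rewrite tor_elt_coord.
  elim/big_rec: _ => [|i _ xi [u Lu <-]].
    by exists 0 => //; exact: (linear0 phi).
  have /dvdzP[c s0E] := coord_graded prim_omega b_theta xs xi.
  pose r0 := d i + c * K%:Z.
  have -> : s0 = r0 * q%:Z + k i.
    by rewrite -[s0](subrK (k i + q%:Z * d i)) s0E PoszM /r0; ring.
  have bi : tnth b i \in graded pi eps r0.
    apply: (mem_graded_mod prim_eps _ (b_pi i)).
    have -> : r0 - d i = c * K%:Z by rewrite /r0; ring.
    by rewrite dvdz_mull.
  set c0 := B (tnth b i) X / m%:R.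
  have Lk : L ((- c0) *: tor_k K B r0 s ord0).
    have [biX|biX] := eqVneq (B (tnth b i) X) 0.
      by rewrite /c0 biX mul0r oppr0 scale0r.
    rewrite -[_ *: _]addr0; apply: Lbar_linear => //; apply: Lbar_k.
    exact: form_X biX.
  exists (coord b i x *: (1 *: tor_elt K B (tnth b i) r0 s
                          + (- c0) *: tor_k K B r0 s ord0) + u).
    by apply: Lbar_linear => //; apply: Lbar_linear => //; apply: Lbar_elt.
  rewrite phiP phiP phiZ twist_k // (twist_elt _ _ _ bb Xb _ _ (Xb i)) //.
  by rewrite scale1r scaleNr addrK.
- move=> s0 s i /dvdzP[c ->]; exists (tor_k K B (c * K%:Z) s i).
    by apply: Lbar_k; rewrite dvdz_mull.
  by rewrite twist_k // PoszM mulrA.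
Qed.

Lemma twist_isomorphism : lie_isomorphism L L' phi.
Proof.
split.
- exact: Lbar_subalgebra.
- exact: Lbar_subalgebra.
- split; first by move=> u /= /twist_Lbar.
    move=> u v _ _; exact: (can_inj (twistK K_gt0 q_gt0 bb Xb)).
  by move=> u /= /twist_Lbar_surj[v Lv <-]; exists v.
- by move=> a u v _ _; rewrite linearP.
- by move=> u v _ _; apply: twist_lie.
Qed.

End TwistLbar.

(** * Invariant forms and automorphisms *)

Section Schur.
Variables (F : numClosedFieldType) (G : finLieAlgType F) (B : invForm G).
Hypothesis simpleG : simple_lie (fullv : {vspace G}).
Hypothesis nondegB : nondegenerate_on B (fullv : {vspace G}).

Lemma radical_eq0 x : (forall y, B x y = 0) -> x = 0.
Proof. by move=> xB; apply: nondegB => [|y _]; rewrite ?memvf. Qed.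

Let d := \dim (fullv : {vspace G}).
Let e := vbasis (fullv : {vspace G}).
Let vec (v : 'rV[F]_d) : G := \sum_i v 0 i *: tnth e i.

Let formE (b : G -> G -> F) (v : 'rV_d) j :
  (forall y, linear (b^~ y : G -> F^o)) ->
  (v *m \matrix_(i, j) b (tnth e i) (tnth e j)) 0 j = b (vec v) (tnth e j).
Proof.
move=> bl; pose g : {linear G -> F^o} := HB.pack (b^~ (tnth e j))
  (GRing.isLinear.Build F G F^o *:%R _ (bl (tnth e j))).
rewrite mxE [RHS](linear_sum g); apply: eq_bigr => i _.
by rewrite mxE linearZ_LR.
Qed.

Let vec0 v : vec v = 0 -> v = 0.
Proof.
move=> v0; apply/rowP => i; rewrite mxE.
have /freeP fr := basis_free (vbasisP (fullv : {vspace G})).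
apply: (fr (v 0)); rewrite -[RHS]v0.
by apply: eq_bigr => j _; rewrite -tnth_nth.
Qed.

(** Schur's lemma: the form [B (f x) (f y)] is invariant as well, and its Gram
   matrix times the inverse Gram matrix of [B] has an eigenvalue c, so that the
   x with [B (f x) (f y) = c * B x y] for all y form a nonzero ideal. *)
Lemma schur_form (f : 'End(G)) : {morph f : x y / lie x y} ->
  exists c, forall x y, B (f x) (f y) = c * B x y.
Proof.
move=> fL; have [_ [x0 [y0 [_ _ xy0]]] idealG] := simpleG.
have d_gt0 : (0 < d)%N.
  rewrite lt0n dimv_eq0; apply: contra_neq xy0 => G0.
  by have := memvf (lie x0 y0); rewrite G0 memv0 => /eqP.
pose M := \matrix_(i < d, j < d) B (tnth e i) (tnth e j).
pose M' := \matrix_(i < d, j < d) B (f (tnth e i)) (f (tnth e j)).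
have eqB (b b' : G -> G -> F) x :
    linear (b x : G -> F^o) -> linear (b' x : G -> F^o) ->
    (forall j, b x (tnth e j) = b' x (tnth e j)) -> b x =1 b' x.
  move=> bl bl' bb' y.
  pose g : {linear G -> F^o} := HB.pack (b x)
    (GRing.isLinear.Build F G F^o *:%R _ bl).
  pose g' : {linear G -> F^o} := HB.pack (b' x)
    (GRing.isLinear.Build F G F^o *:%R _ bl').
  rewrite (coord_sum y (vbasisP _)) [LHS](linear_sum g) [RHS](linear_sum g').
  by apply: eq_bigr => j _; rewrite !linearZ_LR /= bb'.
have uM : M \in unitmx.
  rewrite -row_free_unit -kermx_eq0; apply/rowV0P => v /sub_kermxP vM.
  apply/vec0/radical_eq0; apply: (eqB (fun x y => B x y) (fun _ _ => 0)).
  - by move=> a u u'; rewrite linearPr.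
  - by move=> a u u'; rewrite scaler0 addr0.
  move=> j; rewrite -[LHS](formE (b := fun x y => B x y)) ?vM ?mxE //.
  by move=> y a u u'; rewrite linearPl.
have [c /eigenvalueP[v vc v0]] := eigenvalue_closed (M' *m invmx M) d_gt0.
have vM : v *m M' = c *: (v *m M).
  by rewrite scalemxAl -vc -mulmxA mulmxKV.
have xc : forall y, B (f (vec v)) (f y) = c * B (vec v) y.
  apply: (eqB (fun x y => B (f x) (f y)) (fun x y => c * B x y)).
  - by move=> a u u'; rewrite linearP linearPr.
  - by move=> a u u'; rewrite linearPr /= mulrDr mulrCA.
  move=> j; rewrite -[LHS](formE (b := fun x y => B (f x) (f y))); last first.
    by move=> y a u u'; rewrite linearP linearPl.
  rewrite vM mxE (formE (b := fun x y => B x y)) // => y a u u'.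
  by rewrite linearPl.
have [|a x y Px Py|W WP] :=
    @vspace_of_closed _ G (fun x => forall y, B (f x) (f y) = c * B x y).
- by move=> y; rewrite linear0 !linear0l mulr0.
- by move=> z; rewrite linearP !linearPl /= Px Py mulrDr mulrCA.
exists c => x; apply/WP.
have [W0|-> //] : W = 0%VS \/ W = fullv; last by rewrite memvf.
  apply: idealG; split=> [|z {}x _ /WP Wx]; first exact: subvf.
  apply/WP => y; rewrite lieC linearN !linearNl /= fL !inv_form_lie -fL Wx.
  by rewrite mulrN.
case/eqP: v0; apply: vec0; apply/eqP.
by rewrite -memv0 -W0; apply/WP.
Qed.

End Schur.

(** * Degree in t and eigenvalues of ad X *)

Section LoopDegree.
Variables (F : comNzRingType) (G : lieAlgType F) (B : invForm G).
Variables (Z : lmodType F) (kappa : cocycle int Z) (X : G).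
Local Notation loop := (loop_ext_of B kappa).

(** On u, the derivation ad X is the degree in t up to the shift c. *)
Definition has_degree (c : int) (u : loop) :=
  forall n, lie X (u.1 n) = (n - c)%:~R *: u.1 n.

Lemma has_degree_lie c d (u v : loop) : has_degree c u -> has_degree d v ->
  has_degree (c + d) (lie u v).
Proof.
move=> uc vd; have [P uP] := fsupp_bound u.1; have [Q vQ] := fsupp_bound v.1.
have deg0 : has_degree (c + d) 0 by move=> n; rewrite /= lie0r scaler0.
have degD u' v' : has_degree (c + d) u' -> has_degree (c + d) v' ->
    has_degree (c + d) (u' + v').
  move=> u'd v'd n; have := congr2 +%R (u'd n) (v'd n).
  by rewrite -lieDr -scalerDr.
rewrite [lie u v](loop_lieE uP vQ).
apply: big_ind => // r _; apply: big_ind => // s _ n /=.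
case: eqP => [->|_]; last by rewrite lie0r scaler0.
have -> : r + s - (c + d) = (r - c) + (s - d) by rewrite opprD addrACA.
by rewrite rmorphD; apply: lie_eigen.
Qed.

End LoopDegree.

(** * Generation of G and weights of t *)

Section Structure.
Variables (C : numClosedFieldType) (G : finLieAlgType C) (B : invForm G).
Hypothesis simpleG : simple_lie (fullv : {vspace G}).
Hypothesis nondegB : nondegenerate_on B (fullv : {vspace G}).
Variables (K : nat) (pi : 'End(G)) (eps : C).
Hypotheses (hK : K \in [:: 1%N; 2%N; 3%N]) (prim_eps : K.-primitive_root eps).
Hypotheses (pi_lie : {morph pi : x y / lie x y}) (piK : iter K pi =1 id).
Local Notation G_ := (graded pi eps).
Hypothesis simpleG0 : simple_lie (G_ 0).
Hypotheses (irr1 : irreducible_module (G_ 0) (G_ 1))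
           (irrm1 : irreducible_module (G_ 0) (G_ (-1))).
Variables (t : {vspace G}) (l : nat) (psi : 'I_l.+1 -> dual t).
Variables (H : 'I_l.+1 -> subvs_of t) (E E' : 'I_l.+1 -> G).
Local Notation lift0 := (lift (@ord0 l)).
Hypothesis gens : canonical_generators (G_ 0) (fun j => psi (lift0 j))
  (fun j => H (lift0 j)) (fun j => E (lift0 j)) (fun j => E' (lift0 j)).
Hypothesis E0 : [/\ E ord0 != 0, E ord0 \in G_ 1 &
  weight_vector (psi ord0) (E ord0)].
Hypothesis F0 : [/\ E' ord0 != 0, E' ord0 \in G_ (-1) &
  exists mu : dual t, weight_vector mu (E' ord0)].
Hypothesis EF0 : lie (E ord0) (E' ord0) = vsval (H ord0).
Hypothesis HE0 : lie (vsval (H ord0)) (E ord0) = 2 *: E ord0.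
Hypothesis nondegt : nondegenerate_on B t.

Definition linear_prop (P : G -> Prop) :=
  P 0 /\ forall a x y, P x -> P y -> P (a *: x + y).

(** A property that defines a subalgebra and holds for the E_j and F_j with
   j >= 1 holds on G_[0]. *)
Lemma gen0_ind (P : G -> Prop) : linear_prop P ->
  (forall x y, P x -> P y -> P (lie x y)) ->
  (forall j, P (E (lift0 j)) /\ P (E' (lift0 j))) ->
  forall x, x \in G_ 0 -> P x.
Proof.
move=> [P0 PD] PL PE; have [W WP] := vspace_of_closed P0 PD.
have [_ _ _ _ genT] := gens.
have /subvP sub : (G_ 0 <= W)%VS.
  apply: genT => [x y|j]; first by rewrite !WP; apply: PL.
  by rewrite !WP.
by move=> x /sub /WP.
Qed.

Lemma module_ind (i : int) e (P : G -> Prop) :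
  irreducible_module (G_ 0) (G_ i) -> linear_prop P ->
  (forall x v, x \in G_ 0 -> v \in G_ i -> P v -> P (lie x v)) ->
  e \in G_ i -> e != 0 -> P e -> forall v, v \in G_ i -> P v.
Proof.
move=> [_ _ irr] [P0 PD] PL ei e0 Pe.
have [W WP] := vspace_of_closed P0 PD.
have [|W0|WE v] := irr (W :&: G_ i)%VS.
- split=> [|x v x0]; first exact: capvSr.
  rewrite !memv_cap => /andP[/WP Pv vi]; apply/andP; split; first exact/WP/PL.
  by have := graded_lie prim_eps pi_lie x0 vi; rewrite add0r.
- by case/eqP: e0; apply/eqP; rewrite -memv0 -W0 memv_cap ei andbT; apply/WP.
- by rewrite -WE memv_cap => /andP[/WP].
Qed.

Lemma sum_prim_root (j : nat) :
  \sum_(i < K) eps ^+ (i * j) = if (K %| j)%N then K%:R else 0.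
Proof.
have [/dvdnP[c ->]|Kj] := ifPn.
  rewrite (eq_bigr (fun=> 1)) ?sumr_const ?card_ord // => i _.
  by rewrite mulnA mulnC exprM (prim_expr_order prim_eps) expr1n.
have ej : eps ^+ j - 1 != 0 by rewrite subr_eq0 -(prim_order_dvd prim_eps).
apply: (mulfI ej); rewrite mulr0 (eq_bigr (fun i : 'I_K => (eps ^+ j) ^+ i)).
  rewrite -subrX1 -exprM mulnC exprM (prim_expr_order prim_eps) expr1n.
  by rewrite subrr.
by move=> i _; rewrite -exprM mulnC.
Qed.

(** x is the mean of its components p i, the sums of the
   eps^(i j) pi^j x over j. *)
Lemma graded_span x : x \in lspan [set y | exists i, y \in G_ i].
Proof.
have K_gt0 := prim_order_gt0 prim_eps.
have K0 : K%:R != 0 :> C by rewrite pnatr_eq0 -lt0n.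
pose p (i : nat) := \sum_(j < K) eps ^+ (i * j) *: iter j pi x.
have pG i : p i \in G_ (- i%:Z).
  rewrite mem_graded /p linear_sum scaler_sumr; apply/eqP.
  rewrite -(big_mkord xpredT (fun j => pi (eps ^+ (i * j) *: iter j pi x))).
  rewrite -(big_mkord xpredT
    (fun j => eps ^ (- i%:Z) *: (eps ^+ (i * j) *: iter j pi x))).
  rewrite -(prednK K_gt0) big_nat_recr //= big_nat_recl //= addrC.
  congr (_ + _).
    rewrite linearZ /= -[pi _]/(iter K.-1.+1 pi x) prednK // piK.
    rewrite muln0 expr0 scale1r.
    congr (_ *: _); rewrite -exprnN; apply: (mulIf (x := eps ^+ i)).
      by rewrite -unitfE unitrX // (prim_unit prim_eps).
    rewrite -exprD addnC -mulnS prednK // mulnC exprM.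
    rewrite (prim_expr_order prim_eps) expr1n mulVf //.
    by rewrite -unitfE unitrX // (prim_unit prim_eps).
  apply: eq_big_nat => j _.
  rewrite linearZ /= scalerA mulnS exprD mulrA -exprnN.
  by rewrite mulVf ?mul1r // -unitfE unitrX // (prim_unit prim_eps).
have -> : x = \sum_(i < K) (K%:R)^-1 *: p i.
  rewrite -scaler_sumr exchange_big /=.
  rewrite (eq_bigr
    (fun j : 'I_K => if (K %| j)%N then K%:R *: iter j pi x else 0)).
    rewrite (bigD1 (Ordinal K_gt0)) //= dvdn0 big1.
      by rewrite addr0 scalerA mulVf ?scale1r.
    move=> [[|j] lt_j] //= _; rewrite gtnNdvd //.
  move=> j _; rewrite -scaler_suml sum_prim_root; case: ifP => // _.
  by rewrite scale0r.
by apply: rpred_sum => i _; apply/rpredZ/lspan_gen; exists (- i%:Z).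
Qed.

(** For K <= 3 every residue modulo K is that of 0, 1 or -1. *)
Lemma graded_cases i : [\/ G_ i = G_ 0, G_ i = G_ 1 | G_ i = G_ (-1)].
Proof.
have mK j : (K%:Z %| i - j)%Z -> G_ i = G_ j by apply: graded_mod.
have K_gt0 := prim_order_gt0 prim_eps.
have Kz : K%:Z != 0 by rewrite eqz_nat -lt0n.
have iE := divz_eq i K.
have r_ge : (0 <= (i %% K)%Z)%R by rewrite modz_ge0.
have r_lt : ((i %% K)%Z < K%:Z)%R by apply: ltz_pmod.
move: iE r_ge r_lt; case: (i %% K)%Z => // r iE _ /= rK.
have Kr (j : int) : (K%:Z %| r%:Z - j)%Z -> (K%:Z %| i - j)%Z.
  by move=> Kr; rewrite iE -addrA rpredD // dvdz_mull.
rewrite ltz_nat in rK; case: r {iE} rK Kr => [|[|[|r]]] rK Kr.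
- by constructor 1; apply/mK/Kr; rewrite subrr dvdz0.
- by constructor 2; apply/mK/Kr; rewrite subrr dvdz0.
- constructor 3; apply/mK/Kr; move: hK rK; rewrite !inE.
  by case/or3P => /eqP ->.
- by move: hK rK; rewrite !inE; case/or3P => /eqP ->.
Qed.

(** The E_j and F_j with j >= 0 generate G. *)
Lemma gen_ind (P : G -> Prop) : linear_prop P ->
  (forall x y, P x -> P y -> P (lie x y)) -> (forall j, P (E j) /\ P (E' j)) ->
  forall x, P x.
Proof.
move=> PC PL PE x.
have P_0 : forall x, x \in G_ 0 -> P x by apply: gen0_ind.
have P_1 : forall x, x \in G_ 1 -> P x.
  have [e0 e1 _] := E0; apply: (module_ind irr1 PC _ e1 e0 (PE ord0).1).
  by move=> y v /P_0 Py _; apply: PL.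
have P_m1 : forall x, x \in G_ (-1) -> P x.
  have [e0 e1 _] := F0; apply: (module_ind irrm1 PC _ e1 e0 (PE ord0).2).
  by move=> y v /P_0 Py _; apply: PL.
have /asboolP[s [sP ->]] := graded_span x; case: PC => PC0 PCD.
rewrite big_seq; elim/big_rec: _ => // p y /sP[i pi_] Py; apply: PCD => //.
by case: (graded_cases i) pi_ => -> *; [apply: P_0|apply: P_1|apply: P_m1].
Qed.


Lemma lspan_closed_prop (S : set G) : linear_prop (fun x => x \in lspan S).
Proof. by split=> [|a x y Sx Sy]; rewrite ?rpred0 // rpredD ?rpredZ. Qed.

Lemma lspan_lie (S : set G) : (forall x y, S x -> S y -> lie x y \in lspan S) ->
  forall x y, x \in lspan S -> y \in lspan S -> lie x y \in lspan S.
Proof.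
move=> SL x y xS yS; move: x xS; apply: lspan_ind => [|a x x' Px Px'|x Sx].
- by rewrite lie0l rpred0.
- by rewrite lieDl lieZl rpredD ?rpredZ.
move: y yS; apply: lspan_ind => [|a y y' Py Py'|y Sy]; last exact: SL.
- by rewrite lie0r rpred0.
- by rewrite lieDr lieZr rpredD ?rpredZ.
Qed.

Lemma weight_lie (al be : dual t) x y : weight_vector al x ->
  weight_vector be y -> weight_vector (al + be) (lie x y).
Proof. by move=> ax by_ z; rewrite add_lfunE; apply: lie_eigen. Qed.

Lemma weight_eq (al be : dual t) x : x != 0 ->
  weight_vector al x -> weight_vector be x -> al = be.
Proof.
move=> x0 ax bx; apply/lfunP => z; have /eqP := ax z; rewrite bx.
by rewrite -subr_eq0 -scalerBl scaler_eq0 (negPf x0) orbF subr_eq0 => /eqP.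
Qed.

Lemma t_sub x : x \in t -> x \in G_ 0.
Proof. by have [[/subvP sub _ _ _] _ _ _ _] := gens; apply: sub. Qed.

Definition homweight (x : G) :=
  exists i (al : dual t), x \in G_ i /\ weight_vector al x.

Lemma homweight_E j : homweight (E j) /\ homweight (E' j).
Proof.
case: (unliftP ord0 j) => [j'|] ->.
  have [_ _ wEF _ _] := gens; have [E_0 F_0 wE wF] := wEF j'.
  by split; exists 0; [exists (psi (lift0 j'))|exists (- psi (lift0 j'))].
have [[_ E1 wE] [_ F1 [mu wF]]] := (E0, F0).
by split; [exists 1, (psi ord0)|exists (-1), mu].
Qed.

Lemma homweight_span x : x \in lspan homweight.
Proof.
move: x; apply: (gen_ind (P := fun x => x \in lspan homweight)).
  exact: lspan_closed_prop.
  apply: lspan_lie => x y [i [al [xi ax]]] [j [be [yj by_]]].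
  apply: lspan_gen; exists (i + j), (al + be); split; last exact: weight_lie.
  exact: (graded_lie prim_eps pi_lie xi yj).
by move=> j; have [hE hE'] := homweight_E j; split; apply: lspan_gen.
Qed.

(** Elements of t act diagonalizably on the whole algebra, and nilpotently on
   t. *)
Lemma t_abelian z y : z \in t -> y \in t -> lie z y = 0.
Proof.
move=> zt yt; have [[_ _ [n nilt] _] _ _ _ _] := gens.
have [p [b bb hb]] := basis_of_span homweight_span.
have /choice[c bc] : forall i, exists c, lie z (tnth b i) = c *: tnth b i.
  move=> i; have [j [al [_ /(_ (vsproj t z))]]] := hb i.
  by rewrite vsprojK // => alz; exists (al (vsproj t z)).
have iterE k : iter k (lie z) y = \sum_i (c i ^+ k * coord b i y) *: tnth b i.
  elim: k => [|k IHk] /=.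
    by rewrite {1}(coord_sum y bb); apply: eq_bigr => i _; rewrite mul1r.
  rewrite IHk lie_sumr; apply: eq_bigr => i _.
  by rewrite lieZr bc scalerA exprS -mulrA mulrC.
have niln : iter n (lie z) y = 0.
  rewrite -[RHS](nilt [tuple of nseq n z] y) //=; last by move=> u /nseqP[->].
  by elim: (n) => //= k ->.
have cy i : c i ^+ n * coord b i y = 0.
  have /freeP fr := basis_free bb.
  apply: (fr (fun i => c i ^+ n * coord b i y)).
  by rewrite -[RHS]niln iterE; apply: eq_bigr => j _; rewrite -tnth_nth.
rewrite -[LHS]/(iter 1 (lie z) y) iterE big1 // => i _.
have /eqP := cy i; rewrite mulf_eq0 expf_eq0 => /orP[/andP[_ /eqP->]|/eqP->].
  by rewrite expr1 mul0r scale0r.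
by rewrite mulr0 scale0r.
Qed.

Lemma weight0 x : x \in t -> weight_vector (0 : dual t) x.
Proof. by move=> xt z; rewrite zero_lfunE scale0r t_abelian ?subvsP. Qed.

Lemma coroot_H j : lie (E j) (E' j) = vsval (H j) /\ psi j (H j) = 2.
Proof.
case: (unliftP ord0 j) => [j'|] ->; first by have [_ _ _ + _] := gens; apply.
split=> //; have [e0 _ wE] := E0; have /eqP := wE (H ord0); rewrite HE0.
by rewrite -subr_eq0 -scalerBl scaler_eq0 (negPf e0) orbF subr_eq0 => /eqP <-.
Qed.

Lemma H_neq0 j : vsval (H j) != 0.
Proof.
apply/eqP => Hj; have [_ ] := coroot_H j.
have -> : H j = 0 by apply: val_inj; rewrite /= Hj.
by rewrite linear0 => /esym/eqP; rewrite pnatr_eq0.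
Qed.

Lemma weight_E j : weight_vector (psi j) (E j).
Proof.
case: (unliftP ord0 j) => [j'|] ->; last by have [] := E0.
by have [_ _ wEF _ _] := gens; have [] := wEF j'.
Qed.

(** For j = 0: H_0 = [E_0, F_0] is a nonzero vector of weight 0, so the weight
   of F_0 is opposite to that of E_0. *)
Lemma weight_E' j : weight_vector (- psi j) (E' j).
Proof.
case: (unliftP ord0 j) => [j'|] ->.
  by have [_ _ wEF _ _] := gens; have [] := wEF j'.
have [_ _ [mu wF]] := F0.
have := weight_lie (weight_E ord0) wF; rewrite EF0 => wH.
have wH0 := weight0 (subvsP (H ord0)).
have /eqP := weight_eq (H_neq0 ord0) wH wH0.
by rewrite addrC addr_eq0 => /eqP <-.
Qed.

Lemma psi_form j z :
  psi j z * B (E j) (E' j) = B (vsval z) (vsval (H j)) :> C.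
Proof.
by rewrite -(coroot_H j).1 -inv_form_lie weight_E linearZl_LR.
Qed.

(** Otherwise H_j would be orthogonal to t. *)
Lemma form_EE'_neq0 j : B (E j) (E' j) != 0.
Proof.
apply: contraTneq (H_neq0 j) => B0; rewrite negbK; apply/eqP.
apply: nondegt => [|y yt]; first exact: subvsP.
by rewrite inv_formC -[y](vsprojK yt) -psi_form B0 mulr0.
Qed.

(** A central element of the simple algebra G_[0] is zero. *)
Lemma center0 z : z \in G_ 0 -> (forall x, x \in G_ 0 -> lie z x = 0) -> z = 0.
Proof.
move=> z0 zC; have [_ [x [y [x0 y0 xy]]] ideal0] := simpleG0.
have [||zG] := ideal0 <[z]>%VS.
- split; first by rewrite -memvE.
  move=> u _ u0 /vlineP[c ->]; rewrite lieZr lieC zC // oppr0 scaler0.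
  exact: mem0v.
- by move/eqP; rewrite -subv0 -memvE memv0 => /eqP.
case/eqP: xy; move: x0; rewrite -zG => /vlineP[c ->].
by rewrite lieZl zC ?scaler0.
Qed.

Lemma commutant_closed z : linear_prop (fun x => lie z x = 0).
Proof.
split=> [|a x y zx zy]; first exact: lie0r.
by rewrite lieDr lieZr zx zy scaler0 addr0.
Qed.

Lemma commutant_lie (z x y : G) :
  lie z x = 0 -> lie z y = 0 -> lie z (lie x y) = 0.
Proof. by move=> zx zy; rewrite lie_derivation zx zy lie0l lie0r addr0. Qed.

Lemma commutant_G0 z : z \in G_ 0 ->
  (forall j, lie z (E (lift0 j)) = 0 /\ lie z (E' (lift0 j)) = 0) -> z = 0.
Proof.
move=> z0 zE; apply: center0 => //; apply: gen0_ind => //.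
  exact: commutant_closed.
exact: commutant_lie.
Qed.

(** An element of t killed by all simple roots is central in G_[0]. *)
Lemma psi_separates (z : subvs_of t) : (forall j, psi (lift0 j) z = 0) -> z = 0.
Proof.
move=> pz; apply: val_inj; apply: commutant_G0; first exact/t_sub/subvsP.
move=> j; rewrite (weight_E (lift0 j)) (weight_E' (lift0 j)) opp_lfunE pz.
by rewrite oppr0 !scale0r.
Qed.

(** A linear relation among the psi_j on the H_i holds on all of t: the
   functional is B(u, -) for a combination u of the H_j, and if it vanishes on
   the H_i, then every psi_i(u) is zero. *)
Lemma psi_relation (a : 'I_l.+1 -> nat) :
  (forall i, \sum_j (psi j (H i) : C) *+ a j = 0) ->
  forall z, \sum_j (psi j z : C) *+ a j = 0.
Proof.
move=> aH z.
pose u : subvs_of t := \sum_j ((a j)%:R / B (E j) (E' j)) *: H j.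
have uE y : B (vsval u) (vsval y) = \sum_j (psi j y : C) *+ a j.
  rewrite inv_formC linear_sum linear_sumr; apply: eq_bigr => j _.
  rewrite !linearZ_LR /= -psi_form mulrC -mulrA [_ * (_ / _)]mulrC.
  by rewrite mulfVK ?form_EE'_neq0 // mulr_natr.
suff u0 : u = 0 by rewrite -uE u0 linear0 linear0l.
apply: psi_separates => j; apply: (mulIf (form_EE'_neq0 (lift0 j))).
by rewrite psi_form uE aH mul0r.
Qed.

Lemma exists_X : exists X : subvs_of t, forall j, psi (lift0 j) X = 1.
Proof.
have [_ [freepsi _ _] _ _ _] := gens.
exact: (free_functionals (fun=> 1) freepsi).
Qed.


(** The constant of proportionality is 1 because B(H_0, H_0) = 2 B(E_0, F_0) is
   not zero. *)
Lemma form_preserved (f : 'End(G)) c : {morph f : x y / lie x y} ->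
  f (vsval (H ord0)) = c *: vsval (H ord0) -> c * c = 1 ->
  forall x y, B (f x) (f y) = B x y.
Proof.
move=> fL fH cc x y; have [c' fB] := schur_form simpleG nondegB fL.
have := fB (vsval (H ord0)) (vsval (H ord0)).
rewrite fH linearZ_LR /= linearZl_LR /= mulrA cc mul1r.
rewrite -psi_form (coroot_H ord0).2.
rewrite -[LHS]mul1r fB => /mulIf <-; first by rewrite mul1r.
by rewrite mulf_neq0 ?form_EE'_neq0 // pnatr_eq0.
Qed.

Lemma pi_form x y : B (pi x) (pi y) = B x y.
Proof.
apply: (form_preserved (c := 1)) => //; last by rewrite mulr1.
have := t_sub (subvsP (H ord0)); rewrite mem_graded => /eqP ->.
by rewrite expr0z.
Qed.

(** * Root vectors *)

Local Notation RV := (fun al x i => @root_vector C G pi eps t al x i).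

(** Among the brackets, those of total degree 0 give elements of t, the others
   the zero weight vectors in the other G_[i]. *)
Definition root_gen (x : G) := (exists (al : dual t) i, RV al x i) \/
  (exists (al : dual t) i j u v, [/\ RV al u i, RV (- al) v j & x = lie u v]).

Lemma root_vector_span (al : dual t) x i : al != 0 -> x \in G_ i ->
  weight_vector al x -> x \in lspan root_gen.
Proof.
move=> al0 xi ax; have [->|x0] := eqVneq x 0; first exact: rpred0.
by apply: lspan_gen; left; exists al, i.
Qed.

Lemma opposite_span (al : dual t) x y i j : al != 0 ->
  x \in G_ i -> weight_vector al x -> y \in G_ j -> weight_vector (- al) y ->
  lie x y \in lspan root_gen.
Proof.
move=> al0 xi ax yj ay.
have [->|x0] := eqVneq x 0; first by rewrite lie0l rpred0.
have [->|y0] := eqVneq y 0; first by rewrite lie0r rpred0.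
apply: lspan_gen; right; exists al, i, j, x, y; split=> //.
by split=> //; rewrite oppr_eq0.
Qed.

Lemma psi0_neq0 : psi ord0 != 0.
Proof.
apply/eqP => p0; have := (coroot_H ord0).2; rewrite p0 zero_lfunE.
by move/esym/eqP; rewrite pnatr_eq0.
Qed.

(** The span is an ideal, hence everything: it suffices to bracket with
   homogeneous weight vectors, and these move root vectors to root vectors or to
   brackets of opposite ones. *)
Lemma root_gen_span x : x \in lspan root_gen.
Proof.
have [W0 WD] := lspan_closed_prop root_gen.
have [W WP] := vspace_of_closed W0 WD.
have [_ _ idealG] := simpleG; apply/WP.
have gl u v i j : u \in G_ i -> v \in G_ j -> lie u v \in G_ (i + j).
  exact: (graded_lie prim_eps pi_lie).
suff WI : ideal_of fullv W.
  have [WE|->] := idealG W WI; last exact: memvf.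
  have [/eqP e0 e1 _] := E0; case: e0; apply/eqP; rewrite -memv0 -WE; apply/WP.
  exact: root_vector_span psi0_neq0 e1 (weight_E ord0).
split=> [|y z _ /WP]; first exact: subvf.
move=> zS; apply/WP; move: z zS.
apply: lspan_ind => [|a u v Wu Wv|z zR]; first by rewrite lie0r.
  by rewrite lieDr lieZr; apply: WD.
move: y (homweight_span y).
apply: lspan_ind => [|a u v Wu Wv|y]; first by rewrite lie0l.
  by rewrite lieDl lieZl; apply: WD.
move=> [j [be [yj yw]]]; case: zR => [[al [i [al0 z0 zi zw]]]|].
  have [ba|ba] := eqVneq (be + al) 0.
    have alE : al = - be by apply/eqP; rewrite -addr_eq0 addrC ba.
    have be0 : be != 0 by rewrite -oppr_eq0 -alE.
    by rewrite alE in zw; apply: (opposite_span be0 yj yw zi).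
  exact: (root_vector_span ba (gl _ _ _ _ yj zi) (weight_lie yw zw)).
move=> [al [i [i' [u [v [[al0 u0 ui uw] [_ v0 vi vw] ->]]]]]].
have [be0|be0] := eqVneq be 0; last first.
  have := weight_lie yw (weight_lie uw vw); rewrite subrr addr0 => w3.
  exact: (root_vector_span be0 (gl _ _ _ _ yj (gl _ _ _ _ ui vi)) w3).
rewrite be0 in yw; rewrite lie_derivation rpredD //.
  apply: (opposite_span al0 (gl _ _ _ _ yj ui) _ vi vw).
  by rewrite -[al]add0r; apply: weight_lie.
apply: (opposite_span al0 ui uw (gl _ _ _ _ yj vi)).
by rewrite -[- al]add0r; apply: weight_lie.
Qed.

(** * The Chevalley involution *)

Section Chevalley.
Variable w : 'End(G).
Hypothesis w_lie : {morph w : x y / lie x y}.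
Hypothesis wEE' : forall j, w (E j) = - E' j /\ w (E' j) = - E j.

Lemma wK x : w (w x) = x.
Proof.
move: x; apply: gen_ind => [|x y wx wy|j].
- split=> [|a x y wx wy]; first by rewrite !linear0.
  by rewrite !linearP /= wx wy.
- by rewrite !w_lie wx wy.
- by have [wE1 wE2] := wEE' j; rewrite wE1 wE2 !linearN /= wE1 wE2 !opprK.
Qed.

Lemma E_graded j : exists i, E j \in G_ i /\ E' j \in G_ (- i).
Proof.
case: (unliftP ord0 j) => [j'|] ->.
  by exists 0; rewrite oppr0; have [_ _ wEF _ _] := gens; have [] := wEF j'.
by exists 1; have [_ ? _] := E0; have [_ ? _] := F0.
Qed.

Lemma pi_w_pi x : pi (w (pi x)) = w x.
Proof.
have e0 i : eps ^ i != 0 by rewrite expfz_neq0 // -unitfE (prim_unit prim_eps).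
move: x; apply: gen_ind => [|x y wx wy|j].
- split=> [|a x y wx wy]; first by rewrite !linear0.
  by rewrite !linearP /= wx wy.
- by rewrite !(pi_lie, w_lie) wx wy.
have [i []] := E_graded j; rewrite !mem_graded => /eqP Ei /eqP Fi.
have [wE1 wE2] := wEE' j.
rewrite Ei Fi !linearZ_LR /= wE1 wE2 !linearN /= Ei Fi ?scalerN !scalerA.
by rewrite -invr_expz divff ?mulVf ?scale1r.
Qed.

Lemma w_graded x i : x \in G_ i -> w x \in G_ (- i).
Proof.
have e0 : eps ^ i != 0 by rewrite expfz_neq0 // -unitfE (prim_unit prim_eps).
rewrite !mem_graded => /eqP xi; have := pi_w_pi x.
rewrite xi linearZ_LR /= linearZ_LR /= => wx.
by rewrite -[X in _ == _ *: X]wx scalerA -invr_expz mulVf // scale1r.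
Qed.

(** w z + z lies in G_[0] and commutes with its generators. *)
Lemma w_t z : z \in t -> w z = - z.
Proof.
move=> zt; apply/eqP; rewrite -addr_eq0; apply/eqP; apply: commutant_G0.
  by rewrite rpredD ?(t_sub zt) // -oppr0 w_graded ?t_sub.
have wl u v : lie (w u) v = w (lie u (w v)) by rewrite w_lie wK.
move=> j; have [wE1 wE2] := wEE' (lift0 j).
have := weight_E (lift0 j) (vsproj t z).
have := weight_E' (lift0 j) (vsproj t z).
rewrite vsprojK // !lieDl !wl wE1 wE2 opp_lfunE !lieNr => -> ->.
rewrite !linearN !linearZ_LR /= wE1 wE2 !scaleNr !scalerN !opprK.
by rewrite addNr addrN.
Qed.

Lemma w_form x y : B (w x) (w y) = B x y.
Proof.
apply: (form_preserved (c := -1)) => //; last by rewrite mulrNN mulr1.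
by rewrite w_t ?subvsP // scaleN1r.
Qed.

Lemma w_root_vector al x i : RV al x i -> RV (- al) (w x) (- i).
Proof.
move=> [al0 x0 xi ax]; split; rewrite ?oppr_eq0 ?w_graded //.
  by apply: contraNneq x0 => wx0; rewrite -(wK x) wx0 linear0.
move=> z; have -> : vsval z = - w (vsval z) by rewrite w_t ?opprK ?subvsP.
by rewrite lieNl -w_lie ax linearZ_LR /= opp_lfunE scaleNr.
Qed.

(** Otherwise B(u, w u) = 0 for all root vectors u of weight al, also for
   u = x + w y, whose two summands have the same degree. Then 2 B(x, y) = 0 by
   polarization, since w is an involution that preserves B. *)
Lemma exists_coroot al x y i j : RV al x i -> RV (- al) y j -> B x y != 0 ->
  exists u k, RV al u k /\ B u (w u) != 0.
Proof.
move=> rx ry xy0; apply: contrapT => noU.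
have B0 u k : RV al u k -> B u (w u) = 0.
  by move=> ru; apply/eqP; apply: contra_notT noU => uw; exists u, k.
have [al0 x0 xi ax] := rx; have [_ _ yj _] := ry.
have [_ wy0 wyj awy] := w_root_vector ry; rewrite opprK in awy.
have wyi : w y \in G_ i.
  apply: (mem_graded_mod prim_eps _ wyj); rewrite opprK.
  exact: (inv_form_graded prim_eps pi_form xi yj).
have Bx := B0 _ _ rx; have By : B (w y) y = 0.
  have : RV al (w y) (- j) by [].
  by move/B0; rewrite wK.
have : B (x + w y) (w (x + w y)) = 0.
  have [->|s0] := eqVneq (x + w y) 0; first by rewrite linear0l.
  have sw : weight_vector al (x + w y).
    by move=> z; rewrite lieDr ax awy scalerDr.
  exact: (B0 _ i (And4 al0 s0 (memvD xi wyi) sw)).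
rewrite linearD /= wK linearDl /= !linearDr /= Bx By w_form add0r addr0.
rewrite (inv_formC B y x) -mulr2n => /eqP.
by rewrite mulrn_eq0 /= (negPf xy0).
Qed.

(** t is its own normalizer in G_[0]. *)
Lemma bracket_t al x y i j :
  RV al x i -> RV (- al) y j -> (K%:Z %| i + j)%Z ->
  lie x y \in t.
Proof.
move=> [_ _ xi ax] [_ _ yj ay] Kij; have [[_ _ _ selfn] _ _ _ _] := gens.
apply: selfn => [|z zt].
  have : lie x y \in G_ (i + j) := graded_lie prim_eps pi_lie xi yj.
  by apply: (mem_graded_mod prim_eps); rewrite sub0r rpredN.
have := weight_lie ax ay; rewrite subrr => /(_ (vsproj t z)).
rewrite vsprojK // zero_lfunE scale0r lieC => /(congr1 -%R).
by rewrite opprK oppr0 lieC => ->; rewrite ?oppr0 mem0v.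
Qed.

(** Both brackets lie in t, and B([x, y], z) = al(z) B(x, y) for z in t. *)
Lemma bracket_proportional al x y u v i j i' j' :
  RV al x i -> RV (- al) y j -> RV al u i' -> RV (- al) v j' ->
  (K%:Z %| i + j)%Z -> (K%:Z %| i' + j')%Z ->
  B u v *: lie x y = B x y *: lie u v.
Proof.
move=> rx ry ru rv Kij Kij'; apply/eqP; rewrite -subr_eq0; apply/eqP.
apply: nondegt => [|z zt].
  by rewrite rpredB ?rpredZ //;
    [apply: (bracket_t rx ry)|apply: (bracket_t ru rv)].
have Bz x' y' i1 :
    RV (- al) y' i1 -> B (lie x' y') z = al (vsproj t z) * B x' y'.
  move=> [_ _ _ /(_ (vsproj t z))]; rewrite vsprojK // opp_lfunE scaleNr => ay.
  by rewrite inv_form_lie lieC ay opprK linearZ_LR.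
rewrite linearBl /= !linearZl_LR /= (Bz _ _ _ ry) (Bz _ _ _ rv).
by rewrite mulrCA [B x y * (_ * _)]mulrCA [B x y * _]mulrC subrr.
Qed.

End Chevalley.

(** * The integers N(alpha) *)

Section AffineShift.
Variables (q : nat) (theta : 'End(G)) (omega : C) (X : subvs_of t).
Local Notation m := (K * q)%N.
Hypothesis psiX : forall j, psi (lift0 j) X = 1.
Hypothesis psiX0 : psi ord0 X = 1 - q%:R.
Variables (Phi : affine K B -> affine m B) (Nal : dual t -> int).
Hypothesis Phi_iso : lie_isomorphism (affine_sub B K pi eps)
  (affine_sub B m theta omega) Phi.
Hypothesis PhiE : forall j,
  Phi (aff_elt K B (E (lift0 j)) 0) = aff_elt m B (E (lift0 j)) 1 /\
  Phi (aff_elt K B (E' (lift0 j)) 0) = aff_elt m B (E' (lift0 j)) (-1).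
Hypothesis PhiE0 : Phi (aff_elt K B (E ord0) 1) = aff_elt m B (E ord0) 1.
Hypothesis PhiF0 :
  Phi (aff_elt K B (E' ord0) (-1)) = aff_elt m B (E' ord0) (-1).
Hypothesis PhiN : forall al x r0, RV al x r0 ->
  Phi (aff_elt K B x r0) = aff_elt m B x (Nal al + q%:Z * r0).

(** Phi maps x t^i into the sum over n of the parts of t-degree n on which ad X
   acts by n - q i. As no weight decomposition of x is mentioned, the condition
   defines a subspace that is stable under brackets. *)
Definition degree_shift (i : int) (x : G) :=
  x \in G_ i /\ has_degree (vsval X) (q%:Z * i) (Phi (aff_elt K B x i)).

Lemma aff_sub_elt x i : x \in G_ i -> affine_sub B K pi eps (aff_elt K B x i).
Proof. by move=> xi j /=; case: eqP => [->|_]; rewrite ?mem0v. Qed.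

Lemma degree_shift_closed i : linear_prop (degree_shift i).
Proof.
have [_ _ _ Phi_lin _] := Phi_iso; split.
  split=> [|n]; first exact: mem0v.
  (* Linearity on a subset is stated for a *: x + y only: a = -1 gives
     Phi 0 = 0. *)
  have S0 := aff_sub_elt (mem0v (G_ i)); have := Phi_lin (-1) _ _ S0 S0.
  have -> : aff_elt K B 0 i = 0 by rewrite /aff_elt /loop_elt linear0.
  by rewrite scaler0 addr0 scaleN1r addNr => -> /=; rewrite lie0r scaler0.
move=> a x y [xi dx] [yi dy]; split=> [|n]; first by rewrite rpredD ?rpredZ.
have -> : aff_elt K B (a *: x + y) i = a *: aff_elt K B x i + aff_elt K B y i.
  exact: loop_elt_is_linear.
rewrite Phi_lin; try exact: aff_sub_elt.
have := congr2 (fun u v => a *: u + v) (dx n) (dy n).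
rewrite -lieZr -lieDr /= => h; rewrite [LHS]h.
by rewrite scalerDr scalerA mulrC -scalerA.
Qed.

Lemma degree_shift_lie x y i : degree_shift 0 x -> degree_shift i y ->
  degree_shift i (lie x y).
Proof.
move=> [x0 dx] [yi dy]; have [_ _ _ _ PhiL] := Phi_iso; split.
  by have := graded_lie prim_eps pi_lie x0 yi; rewrite add0r.
have -> : aff_elt K B (lie x y) i = lie (aff_elt K B x 0) (aff_elt K B y i).
  rewrite /aff_elt lie_loop_elt /= /affine_cocycle_fun mul0r add0r.
  by rewrite if_same scaler0 /central_elt; congr pair; rewrite /= addr0.
rewrite PhiL; try exact: aff_sub_elt.
by have := has_degree_lie dx dy; rewrite mulr0 add0r.
Qed.

Lemma has_degree_elt (c n : int) x : lie (vsval X) x = (n - c)%:~R *: x ->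
  has_degree (vsval X) c (aff_elt m B x n).
Proof.
by move=> Xx i /=; case: eqP => [->|_]; rewrite ?Xx // lie0r scaler0.
Qed.

Lemma degree_shift0 x : x \in G_ 0 -> degree_shift 0 x.
Proof.
move: x; apply: gen0_ind; first exact: degree_shift_closed.
  by move=> x y; apply: degree_shift_lie.
move=> j; have [_ _ wEF _ _] := gens; have [Ej Fj wEj wFj] := wEF j.
have [PE PF] := PhiE j; split; split=> //; rewrite ?PE ?PF mulr0;
  apply: has_degree_elt.
  by rewrite wEj psiX subr0.
by rewrite wFj opp_lfunE psiX subr0.
Qed.

Lemma degree_shift1 x : x \in G_ 1 -> degree_shift 1 x.
Proof.
have [e0 e1 we] := E0; move: x.
apply: (module_ind irr1 (degree_shift_closed 1) _ e1 e0).
  by move=> x v x0 _; apply: (degree_shift_lie (degree_shift0 x0)).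
split=> //; rewrite PhiE0; apply: has_degree_elt.
by rewrite we psiX0 mulr1 rmorphB.
Qed.

Lemma degree_shiftm1 x : x \in G_ (-1) -> degree_shift (-1) x.
Proof.
have [e0 e1 _] := F0; move: x.
apply: (module_ind irrm1 (degree_shift_closed (-1)) _ e1 e0).
  by move=> x v x0 _; apply: (degree_shift_lie (degree_shift0 x0)).
split=> //; rewrite PhiF0; apply: has_degree_elt.
rewrite (weight_E' ord0) opp_lfunE psiX0 mulrN1 opprK opprB.
by rewrite [-1 + _]addrC rmorphB.
Qed.

(** x belongs to one of G_[0], G_[1], G_[-1], and there Phi(x t^j) is known both
   from the subspace above and from N(alpha). *)
Lemma Nal_X al x i : RV al x i -> al X = (Nal al)%:~R.
Proof.
move=> [al0 x0 xi ax].
have [j xj hx] : exists2 j, x \in G_ j & degree_shift j x.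
  case: (graded_cases i) xi => -> xj.
  - by exists 0 => //; apply: degree_shift0.
  - by exists 1 => //; apply: degree_shift1.
  - by exists (-1) => //; apply: degree_shiftm1.
have /PhiN PhiX : RV al x j by [].
have [_ /(_ (Nal al + q%:Z * j))] := hx; rewrite PhiX /= eqxx addrK ax => /eqP.
by rewrite -subr_eq0 -scalerBl scaler_eq0 (negPf x0) orbF subr_eq0 => /eqP.
Qed.

(** Phi maps into the affine algebra of theta, which reveals how theta acts. *)
Lemma root_vector_theta al x i : RV al x i ->
  x \in graded theta omega (Nal al + q%:Z * i).
Proof.
move=> rx; have [_ _ xi _] := rx; have [_ _ [PhiS _ _] _ _] := Phi_iso.
have := PhiS _ (aff_sub_elt xi) (Nal al + q%:Z * i).
by rewrite (PhiN rx) /= eqxx.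
Qed.

(** * Assembling the isomorphism *)

Hypotheses (q_gt0 : (0 < q)%N) (prim_omega : m.-primitive_root omega).
Hypothesis theta_lie : {morph theta : x y / lie x y}.
Hypothesis thetaH0 : theta (vsval (H ord0)) = vsval (H ord0).

Lemma X_root_vector al x i : RV al x i ->
  lie (vsval X) x = (Nal al)%:~R *: x.
Proof. by move=> rx; have [_ _ _ ->] := rx; rewrite (Nal_X rx). Qed.

Lemma Nal_opp al x y i j : RV al x i -> RV (- al) y j -> Nal (- al) = - Nal al.
Proof.
move=> rx ry; apply: (@intr_inj C).
by rewrite mulrNz -(Nal_X rx) -(Nal_X ry) opp_lfunE.
Qed.

(** For a bracket of opposite root vectors the two shifts N cancel. *)
Lemma root_gen_basis : exists n (b : n.-tuple G) (k d : 'I_n -> int),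
  [/\ basis_of fullv b, forall i, root_gen (tnth b i),
      forall i, lie (vsval X) (tnth b i) = (k i)%:~R *: tnth b i,
      forall i, tnth b i \in G_ (d i)
    & forall i, tnth b i \in graded theta omega (k i + q%:Z * d i)].
Proof.
have [n [b bb bR]] := basis_of_span root_gen_span.
have /choice[kd kdP] : forall i, exists kd : int * int,
    [/\ lie (vsval X) (tnth b i) = kd.1%:~R *: tnth b i, tnth b i \in G_ kd.2
      & tnth b i \in graded theta omega (kd.1 + q%:Z * kd.2)].
  move=> i; case: (bR i) => [[al [j rx]]|[al [j [j' [u [v [ru rv ->]]]]]]].
    exists (Nal al, j); split; first exact: (X_root_vector rx).
      by case: rx.
    exact: root_vector_theta.
  have [[_ _ uj _] [_ _ vj _]] := (ru, rv).
  exists (0, j + j'); split => /=.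
  - have := lie_eigen (X_root_vector ru) (X_root_vector rv).
    by rewrite (Nal_opp ru rv) mulrNz subrr.
  - exact: (graded_lie prim_eps pi_lie uj vj).
  have := graded_lie prim_omega theta_lie (root_vector_theta ru)
    (root_vector_theta rv).
  by rewrite addrACA (Nal_opp ru rv) subrr -mulrDr.
exists n, b, (fun i => (kd i).1), (fun i => (kd i).2).
by split=> // i; have [] := kdP i.
Qed.

(** Choose y in t with al(y) <> 0; then al(y) B(x, z) = B([y, x], z) = 0,
   because t is abelian. *)
Lemma root_vector_form al x i z : RV al x i -> z \in t -> B x z = 0.
Proof.
move=> [al0 x0 xi ax] zt.
have [y aly] : exists y, al y != 0.
  apply: contrapT => noy; case/eqP: al0; apply/lfunP => y; rewrite zero_lfunE.
  by apply/eqP; apply: contra_notT noy => aly; exists y.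
have : (al y : C) * B x z = 0.
  rewrite -linearZl_LR /= -ax lieC linearNl /= inv_form_lie.
  by rewrite t_abelian ?subvsP // linear0 oppr0.
by move/eqP; rewrite mulf_eq0 (negPf aly) => /eqP.
Qed.

Lemma form_bracket_X be x y j : RV be y j ->
  B (lie x y) (vsval X) = - ((Nal be)%:~R * B x y).
Proof.
by move=> ry; rewrite inv_form_lie lieC (X_root_vector ry) linearN linearZ_LR.
Qed.

Variables (w : 'End(G)) (N : nat).
Hypothesis w_lie : {morph w : x y / lie x y}.
Hypothesis wEE' : forall j, w (E j) = - E' j /\ w (E' j) = - E j.
Local Notation L := (Lbar B K N pi eps).

Lemma theta_form x y : B (theta x) (theta y) = B x y.
Proof.
by apply: (form_preserved (c := 1)) => //; rewrite ?mulr1 // scale1r.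
Qed.

Lemma twist_formulas n (b : n.-tuple G) k : basis_of fullv b ->
  (forall i, lie (vsval X) (tnth b i) = (k i)%:~R *: tnth b i) ->
  formulas pi w eps Nal
    (twist q (vsval X) b k : toroidal K N B -> toroidal m N B).
Proof.
move=> bb Xb; have K_gt0 := prim_order_gt0 prim_eps.
have tE := twist_elt B K_gt0 q_gt0 bb Xb.
rewrite /formulas mulKn //; split.
- move=> al x r0 r [i rx] _; rewrite (tE _ _ _ r0 r (X_root_vector rx)).
  by rewrite (root_vector_form rx) ?subvsP // mul0r scale0r addr0.
- move=> al x r0 r [i rx] _; set h := lie x (w x).
  have rwx := w_root_vector w_lie wEE' rx.
  have Xh : lie (vsval X) h = 0%:~R *: h.
    have := lie_eigen (X_root_vector rx) (X_root_vector rwx).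
    by rewrite (Nal_opp rx rwx) mulrNz subrr.
  rewrite (tE _ _ _ r0 r Xh) addr0 (form_bracket_X _ rwx) (Nal_opp rx rwx).
  by rewrite mulrNz !mulNr opprK [_ * B x _]mulrC -mulrA.
- by move=> r0 r i _; rewrite twist_k.
move=> al be x y r0 r [i rx] [j ry] xy0 _.
have Xxy := lie_eigen (X_root_vector rx) (X_root_vector ry).
rewrite -rmorphD in Xxy; rewrite (tE _ _ _ r0 r Xxy) (form_bracket_X _ ry) xy0.
by rewrite mulr0 oppr0 mul0r scale0r addr0 addrA.
Qed.

(** L-bar is spanned by central elements and by [tnth b i] t^r0 t^r. On the
   latter the first formula applies to a root vector, the fourth to a bracket
   [y, z] with B(y, z) = 0, and any other bracket is a multiple of some
   [v0, w v0], to which the second applies. *)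
Lemma formulas_unique n (b : n.-tuple G) d
    (phi phi' : toroidal K N B -> toroidal m N B) :
  basis_of fullv b -> (forall i, root_gen (tnth b i)) ->
  (forall i, tnth b i \in G_ (d i)) ->
  linear_on L phi -> linear_on L phi' ->
  formulas pi w eps Nal phi -> formulas pi w eps Nal phi' ->
  forall u, L u -> phi' u = phi u.
Proof.
move=> bb bR bd lphi lphi' [f1 f2 f3 f4] [f1' f2' f3' f4'].
have [L0 _ _] := Lbar_subalgebra prim_eps pi_lie pi_form N.
suff : forall u, L u -> L u /\ phi' u = phi u by move=> Lphi u /Lphi[].
have closedP a u v : (L u /\ phi' u = phi u) -> (L v /\ phi' v = phi v) ->
    L (a *: u + v) /\ phi' (a *: u + v) = phi (a *: u + v).
  move=> [Lu uE] [Lv vE]; split; first exact: Lbar_linear.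
  by rewrite lphi // lphi' // uE vE.
have P0 : L 0 /\ phi' 0 = phi 0.
  split=> //; have := lphi (-1) 0 0 L0 L0; have := lphi' (-1) 0 0 L0 L0.
  by rewrite scaler0 addr0 !scaleN1r !addNr => -> ->.
move=> u.
apply: (Lbar_ind (P := fun u => L u /\ phi' u = phi u)) => //; last first.
  by move=> r0 r i Kr; split; [apply: Lbar_k|rewrite f3 ?f3' //; apply: Lbar_k].
move=> x r0 r xr; rewrite (tor_elt_coord _ bb).
elim/big_rec: _ => // i v xi Pv; apply: closedP => //.
have bi : tnth b i \in G_ r0.
  exact: (mem_graded_mod prim_eps (coord_graded bb prim_eps bd xr xi) (bd i)).
have Lb : L (tor_elt K B (tnth b i) r0 r) by apply: Lbar_elt.
split=> //; case: (bR i) => [[al [j rx]]|].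
  by rewrite (f1 al) ?(f1' al) //; exists j.
move=> [al [j [j' [y [z [ry rz bE]]]]]]; rewrite bE in bi Lb *.
have [yz0|yz0] := eqVneq (B y z) 0.
  by rewrite (f4 al (- al)) ?(f4' al (- al)) //;
    [exists j|exists j'|exists j|exists j'].
have [_ _ yj _] := ry; have [_ _ zj _] := rz.
have Kjj := inv_form_graded prim_eps pi_form yj zj yz0.
have [v0 [k [rv vv]]] := exists_coroot w_lie wEE' ry rz yz0.
have rwv := w_root_vector w_lie wEE' rv.
have yzE : lie y z = (B y z / B v0 (w v0)) *: lie v0 (w v0).
  have := bracket_proportional ry rz rv rwv Kjj.
  rewrite subrr dvdz0 => /(_ isT) e.
  by rewrite mulrC -scalerA -e scalerA mulVf ?scale1r.
have Kr0 : lie v0 (w v0) \in G_ r0.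
  have -> : lie v0 (w v0) = (B v0 (w v0) / B y z) *: lie y z.
    by rewrite yzE scalerA mulrA divfK // divff ?scale1r.
  exact: rpredZ.
rewrite yzE; have -> c : tor_elt K B (c *: lie v0 (w v0)) r0 r =
    c *: tor_elt K B (lie v0 (w v0)) r0 r + 0 :> toroidal K N B.
  by rewrite addr0 /tor_elt linearZ_LR.
have Lv : L (tor_elt K B (lie v0 (w v0)) r0 r) by apply: Lbar_elt.
rewrite lphi // lphi' // P0.2; congr (_ *: _ + _).
by rewrite (f2 al) ?(f2' al) //; exists k.
Qed.

Theorem Lbar_isomorphism : exists phi : toroidal K N B -> toroidal m N B,
  [/\ lie_isomorphism L (Lbar B m N theta omega) phi,
      formulas pi w eps Nal phi
    & forall phi' : toroidal K N B -> toroidal m N B,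
        linear_on L phi' -> formulas pi w eps Nal phi' ->
        forall u, L u -> phi' u = phi u].
Proof.
have [n [b [k [d [bb bR Xb bpi btheta]]]]] := root_gen_basis.
have K_gt0 := prim_order_gt0 prim_eps.
have iso := twist_isomorphism N K_gt0 q_gt0 bb Xb prim_eps prim_omega pi_lie
  theta_lie pi_form theta_form (t_sub (subvsP X)) bpi btheta.
have fphi := twist_formulas bb Xb.
exists (twist q (vsval X) b k); split=> // phi' lphi' fphi'.
have [_ _ _ lphi _] := iso.
exact: (formulas_unique bb bR bpi lphi lphi').
Qed.

End AffineShift.

End Structure.

Theorem mainTheorem5 (R : realType)
  (G : finLieAlgType R[i]) (B : invForm G)
  (hG : simple_lie (fullv : {vspace G}))
  (hB : nondegenerate_on B (fullv : {vspace G}))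
  (K : nat) (hK : K \in [:: 1%N; 2%N; 3%N])
  (h : {vspace G}) (hh : cartan_subalgebra fullv h)
  (pi : 'End(G)) (hpi : automorphism pi) (hpiK : has_order pi K)
  (hpih : induced_by_diagram h pi)
  (eps : R[i]) (heps : K.-primitive_root eps)
  (hG0 : simple_lie (graded pi eps 0))
  (hG1 : irreducible_module (graded pi eps 0) (graded pi eps 1))
  (hGm1 : irreducible_module (graded pi eps 0) (graded pi eps (-1)))
  (hG1m1 : contragredient_modules (graded pi eps 0) (graded pi eps 1)
             (graded pi eps (-1)))
  (* indices 0, ..., l: ord0 is 0, and lift ord0 j is j + 1 *)
  (t : {vspace G}) (hth : (t <= h)%VS)
  (l : nat) (psi : 'I_l.+1 -> dual t) (H : 'I_l.+1 -> subvs_of t)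
  (E F : 'I_l.+1 -> G)
  (hEF : canonical_generators (graded pi eps 0) (fun j => psi (lift ord0 j))
     (fun j => H (lift ord0 j)) (fun j => E (lift ord0 j))
     (fun j => F (lift ord0 j)))
  (hE0 : [/\ E ord0 != 0, E ord0 \in graded pi eps 1,
     weight_vector (psi ord0) (E ord0)
     & forall j : 'I_l, lie (F (lift ord0 j)) (E ord0) = 0])
  (hF0 : [/\ F ord0 != 0, F ord0 \in graded pi eps (-1),
     exists mu : dual t, weight_vector mu (F ord0)
     & forall j : 'I_l, lie (E (lift ord0 j)) (F ord0) = 0])
  (hH0 : lie (E ord0) (F ord0) = vsval (H ord0))
  (hH0E0 : lie (vsval (H ord0)) (E ord0) = 2 *: E ord0)
  (A : 'M[int]_l.+1) (hA : forall i j, psi j (H i) = (A i j)%:~R)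
  (hAaff : affine_cartan_matrix A R)
  (a a1 : 'I_l.+1 -> nat)
  (ha : coprime_positive a) (hAa : A *m (\col_j (a j)%:Z) = 0)
  (ha1 : coprime_positive a1) (ha1A : (\row_i (a1 i)%:Z) *m A = 0)
  (ha0 : a ord0 = 1%N)
  (hBt : nondegenerate_on B t)
  (hBpsi0 : dual_form B (psi ord0) (psi ord0) = 2 * (a1 ord0)%:R / K%:R)
  (m : nat) (hm : m = (K * \sum_j a j)%N)
  (omega : R[i]) (homega : m.-primitive_root omega)
  (theta : 'End(G)) (htheta : automorphism theta)
  (hthetam : has_order theta m)
  (hthetaE : forall j, theta (vsval (H j)) = vsval (H j) /\
                       theta (E j) = omega *: E j)
  (Nal : dual t -> int)
  (hNal : exists Phi : affine K B -> affine m B,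
     [/\ lie_isomorphism (affine_sub B K pi eps) (affine_sub B m theta omega)
           Phi,
         forall j : 'I_l,
           Phi (aff_elt K B (E (lift ord0 j)) 0)
             = aff_elt m B (E (lift ord0 j)) 1 /\
           Phi (aff_elt K B (F (lift ord0 j)) 0)
             = aff_elt m B (F (lift ord0 j)) (-1),
         Phi (aff_elt K B (E ord0) 1) = aff_elt m B (E ord0) 1,
         Phi (aff_elt K B (F ord0) (-1)) = aff_elt m B (F ord0) (-1)
       & forall al x r0, root_vector pi eps al x r0 ->
           Phi (aff_elt K B x r0)
             = aff_elt m B x (Nal al + (m %/ K)%N%:Z * r0)])
  (w : 'End(G)) (hw : automorphism w)
  (hwEF : forall j, w (E j) = - F j /\ w (F j) = - E j)
  (N : nat) :
  exists phi : toroidal K N B -> toroidal m N B,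
    [/\ lie_isomorphism (Lbar B K N pi eps) (Lbar B m N theta omega) phi,
        formulas pi w eps Nal phi
      & forall phi' : toroidal K N B -> toroidal m N B,
          linear_on (Lbar B K N pi eps) phi' -> formulas pi w eps Nal phi' ->
          forall u, Lbar B K N pi eps u -> phi' u = phi u].
Proof.
have [_ pi_lie] := hpi; have [_ piK _] := hpiK.
have [_ theta_lie] := htheta; have [_ w_lie] := hw.
have [E0n E0g E0w _] := hE0; have [F0n F0g F0w _] := hF0.
have E0 := And3 E0n E0g E0w; have F0 := And3 F0n F0g F0w.
set q := (\sum_j a j)%N in hm; have K_gt0 := prim_order_gt0 heps.
have q_gt0 : (0 < q)%N by rewrite /q (bigD1 ord0) //= ha0.
have [X psiX] := exists_X hEF.
have psiX0 : psi ord0 X = 1 - q%:R.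
  have Ha i : \sum_j (psi j (H i) : R[i]) *+ a j = 0.
    have /matrixP/(_ i 0) := hAa.
    rewrite !mxE => /(congr1 (intr : int -> R[i])).
    rewrite rmorph_sum rmorph0 /= => Ai; rewrite -[RHS]Ai.
    by apply: eq_bigr => j _; rewrite mxE hA -mulr_natr rmorphM.
  have := psi_relation hK heps pi_lie piK hG0 hG1 hGm1 hEF E0 F0 hH0 hH0E0
    hBt Ha X.
  rewrite big_ord_recl ha0 mulr1n => /eqP; rewrite addr_eq0 => /eqP ->.
  rewrite /q big_ord_recl ha0 natrD opprD addNKr natr_sum.
  by congr (- _); apply: eq_bigr => j _; rewrite psiX.
subst m; rewrite mulKn // in hNal.
have [Phi [Phi_iso PhiE PhiE0 PhiF0 PhiN]] := hNal.
exact: (Lbar_isomorphism hG hB hK heps pi_lie piK hG0 hG1 hGm1 hEF E0 F0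
  hH0 hH0E0 hBt psiX psiX0 Phi_iso PhiE PhiE0 PhiF0 PhiN q_gt0 homega theta_lie
  (hthetaE ord0).1 N w_lie hwEF).
Qed.
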